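(* In an adaptive Fibonacci heap (as defined in the context) containing $n$ nodes, the operation EXTRACT-MIN runs in $O(\lg n)$ amortized time, with respect to the potential $\Phi(H)=t(H)+2m(H)$, where $t(H)$ is the number of roots and $m(H)$ the number of marked nodes of $H$ (with INSERT, FIND-MIN, UNION and DECREASE-KEY having $O(1)$ amortized cost under the same potential).
   Context: An adaptive Fibonacci heap $H$ storing $H.n$ elements with totally ordered keys is a collection of heap-ordered rooted trees (every node's key is at least its parent's key); comparisons $x<y$ between nodes compare keys. Each node $x$ stores a key, a parent pointer $x.parent$ (NIL for roots), a circular doubly linked list of its children, $x.degree$ = its number of children, and a boolean mark. The roots form a circular doubly linked root list; $H.min$ points to a root of minimum key. All lists are iterated from the oldest-added element to the newest-added one. ''Linking $y$ as a child of $x$'' means removing $y$ from its current list, making it a child of $x$, incrementing $x.degree$, and unmarking $y$. INSERT, FIND-MIN, UNION and DECREASE-KEY are exactly those of the Fibonacci heap (Cormen–Leiserson–Rivest–Stein, Ch. 19): INSERT adds a new unmarked root of degree 0; UNION concatenates root lists; DECREASE-KEY$(x,k)$ lowers the key of $x$ and, if now $x<x.parent=y$, cuts $x$ (moves it, unmarked, to the root list, decrementing $y.degree$) and then performs a cascading cut on $y$: if $y$ is not a root, then if $y$ is unmarked it is marked, and if it is marked it is cut and the cascading cut recurses on its parent. EXTRACT-MIN$(H)$: remove $z=H.min$ from the root list, move every child of $z$ to the root list with parent NIL; if the root list becomes empty set $H.min=$ NIL, otherwise call CONSOLIDATE$(H)$; decrement $H.n$; return $z$. CONSOLIDATE$(H)$: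 allocate an array $A[0\dots D(H.n)]$ with all entries NIL (where $D(n)$ is an upper bound on the maximum degree); for each node $x$ of the root list (in list order) call APPEND$(x, x.degree, A)$; then create a new empty root list and, for each non-NIL entry $x$ of $A$ with $x.parent=$ NIL, insert $x$ into the root list, updating $H.min$ if $x<H.min$. APPEND$(x,d,A)$: let $y=A[d]$. If $y=$ NIL, nothing else is done before the final step. Else if $y<x$: if $y.degree=d$, link $x$ as a child of $y$; then, if $y.parent=$ NIL, call APPEND$(y, y.degree, A)$. Else (i.e. $y\ge x$), if $y.parent=$ NIL, link $y$ as a child of $x$. Finally, in all cases, set $A[d]=x$. *)

(* Defs.v *)
From mathcomp Require Import all_boot all_order all_algebra.
From mathcomp Require Import finmap.
From mathcomp Require Import reals exp.

Set Implicit Arguments.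
Unset Strict Implicit.
Unset Printing Implicit Defensive.

Import Order.TTheory GRing.Theory Num.Theory.

Local Open Scope fset_scope.

(* Cost convention: one unit per constant-time block of pointer operations
   (a list removal, insertion or concatenation, a field update, a comparison),
   per iteration of a loop, and per recursive call. The circular doubly linked
   lists are sequences ordered from the oldest to the newest element, so [rem],
   [rcons] and [++] below each stand for a constant-time list operation. *)

Definition addr : Type := nat.

Section Heap.
Context {disp : Order.disp_t} {K : orderType disp}.

Record node := Node {
  key : K;
  parent : option addr;
  children : seq addr;
  degree : nat;
  mark : bool
}.

(* [store H x] is meaningful only for [x \in nodes H]. *)
Record heap := Heap {
  nodes : {fset addr};
  store : addr -> node;
  roots : seq addr;
  hmin : option addr;
  hn : nat
}.

Definition with_key (k : K) (v : node) : node :=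
  Node k (parent v) (children v) (degree v) (mark v).
Definition with_parent (p : option addr) (v : node) : node :=
  Node (key v) p (children v) (degree v) (mark v).
Definition with_mark (b : bool) (v : node) : node :=
  Node (key v) (parent v) (children v) (degree v) b.
Definition add_child (x : addr) (v : node) : node :=
  Node (key v) (parent v) (rcons (children v) x) (degree v).+1 (mark v).
Definition del_child (x : addr) (v : node) : node :=
  Node (key v) (parent v) (rem x (children v)) (degree v).-1 (mark v).

Definition upd (H : heap) (x : addr) (f : node -> node) : heap :=
  Heap (nodes H) (fun y => if y == x then f (store H y) else store H y)
       (roots H) (hmin H) (hn H).
Definition with_nodes (s : {fset addr}) (H : heap) : heap :=
  Heap s (store H) (roots H) (hmin H) (hn H).
Definition with_roots (r : seq addr) (H : heap) : heap :=
  Heap (nodes H) (store H) r (hmin H) (hn H).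
Definition with_min (m : option addr) (H : heap) : heap :=
  Heap (nodes H) (store H) (roots H) m (hn H).
Definition with_n (n : nat) (H : heap) : heap :=
  Heap (nodes H) (store H) (roots H) (hmin H) n.

Definition node_lt (H : heap) (x y : addr) : bool :=
  (key (store H x) < key (store H y))%O.

Definition update_min (H : heap) (x : addr) : heap :=
  if hmin H is Some m then
    if node_lt H x m then with_min (Some x) H else H
  else with_min (Some x) H.

Definition potential (H : heap) : nat :=
  size (roots H) + 2 * #|` [fset x in nodes H | mark (store H x)] |.

(* The initial memory contents are arbitrary. *)
Definition make_heap (M : addr -> node) : heap :=
  Heap fset0 M [::] None 0.

Definition insert (H : heap) (x : addr) (k : K) : heap * nat :=
  let H1 := upd H x (fun=> Node k None [::] 0 false) in
  let H2 := with_roots (rcons (roots H1) x) (with_nodes (x |` nodes H1) H1) in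
  (with_n (hn H2).+1 (update_min H2 x), 1).

Definition find_min (H : heap) : option addr * nat := (hmin H, 1).

(* Intended for [nodes H1] and [nodes H2] disjoint: the two heaps then occupy
   disjoint parts of one memory, and merging [store] costs nothing. *)
Definition union (H1 H2 : heap) : heap * nat :=
  let M x := if x \in nodes H1 then store H1 x else store H2 x in
  let m := match hmin H1, hmin H2 with
           | None, m2 => m2
           | m1, None => m1
           | Some x1, Some x2 =>
               if (key (M x2) < key (M x1))%O then Some x2 else Some x1
           end in
  (Heap (nodes H1 `|` nodes H2) M (roots H1 ++ roots H2) m (hn H1 + hn H2), 1).

Definition cut (H : heap) (x y : addr) : heap :=
  let H1 := upd H y (del_child x) in
  let H2 := with_roots (rcons (roots H1) x) H1 in
  upd H2 x (fun v => with_mark false (with_parent None v)).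

(* Big-step semantics [start ... end cost]. *)
Inductive cascading_cut : heap -> addr -> heap -> nat -> Prop :=
| CascadeRoot H y :
    parent (store H y) = None -> cascading_cut H y H 1
| CascadeMark H y p :
    parent (store H y) = Some p -> mark (store H y) = false ->
    cascading_cut H y (upd H y (with_mark true)) 1
| CascadeCut H y p H' c :
    parent (store H y) = Some p -> mark (store H y) = true ->
    cascading_cut (cut H y p) p H' c ->
    cascading_cut H y H' (1 + 1 + c).

Inductive decrease_key (H : heap) (x : addr) (k : K) : heap -> nat -> Prop :=
| DecreaseStay :
    let H0 := upd H x (with_key k) in
    (forall y, parent (store H0 x) = Some y -> ~~ node_lt H0 x y) ->
    decrease_key H x k (update_min H0 x) 1
| DecreaseCut y H1 c :
    let H0 := upd H x (with_key k) in
    parent (store H0 x) = Some y -> node_lt H0 x y ->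
    cascading_cut (cut H0 x y) y H1 c ->
    decrease_key H x k (update_min H1 x) (1 + 1 + c).

(* [link H y x] makes [y] a child of [x]. *)
Definition link (H : heap) (y x : addr) : heap :=
  let H1 := if parent (store H y) is Some p then upd H p (del_child y)
            else with_roots (rem y (roots H)) H in
  let H2 := upd H1 x (add_child y) in
  upd H2 y (fun v => with_mark false (with_parent (Some x) v)).

Definition array : Type := seq (option addr).

(* [append H A x d H' A' c]; there is no rule for an access outside the array,
   so such a run is stuck. *)
Inductive append :
  heap -> array -> addr -> nat -> heap -> array -> nat -> Prop :=
| AppendNil H A x d :
    d < size A -> nth None A d = None ->
    append H A x d H (set_nth None A d (Some x)) 1
| AppendLtRoot H A x d y H' A' c :
    d < size A -> nth None A d = Some y -> node_lt H y x ->
    let H1 := if degree (store H y) == d then link H x y else H in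
    parent (store H1 y) = None ->
    append H1 A y (degree (store H1 y)) H' A' c ->
    append H A x d H' (set_nth None A' d (Some x))
           (1 + (degree (store H y) == d) + c)
| AppendLtNonroot H A x d y p :
    d < size A -> nth None A d = Some y -> node_lt H y x ->
    let H1 := if degree (store H y) == d then link H x y else H in
    parent (store H1 y) = Some p ->
    append H A x d H1 (set_nth None A d (Some x))
           (1 + (degree (store H y) == d))
| AppendGe H A x d y :
    d < size A -> nth None A d = Some y -> ~~ node_lt H y x ->
    append H A x d
           (if parent (store H y) == None then link H y x else H)
           (set_nth None A d (Some x))
           (1 + (parent (store H y) == None)).

Inductive append_all :
  heap -> array -> seq addr -> heap -> array -> nat -> Prop :=
| AppendAllNil H A : append_all H A [::] H A 0
| AppendAllCons H A x s H1 A1 c1 H2 A2 c2 :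
    append H A x (degree (store H x)) H1 A1 c1 ->
    append_all H1 A1 s H2 A2 c2 ->
    append_all H A (x :: s) H2 A2 (1 + c1 + c2).

Definition add_root (H : heap) (e : option addr) : heap :=
  if e is Some x then
    if parent (store H x) == None
    then update_min (with_roots (rcons (roots H) x) H) x
    else H
  else H.

Definition rebuild (H : heap) (A : array) : heap :=
  foldl add_root (with_min None (with_roots [::] H)) A.

(* The loop runs over the root list as it stands at the start: the nodes that
   [append] unlinks from that list have all been visited already. The two
   summands [(D (hn H)).+1] pay for the initialisation and the final scan of
   the array. *)
Inductive consolidate (D : nat -> nat) (H : heap) : heap -> nat -> Prop :=
| Consolidate H1 A1 c :
    append_all H (nseq (D (hn H)).+1 None) (roots H) H1 A1 c ->
    consolidate D H (rebuild H1 A1) ((D (hn H)).+1 + c + (D (hn H)).+1).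

Definition remove_min (H : heap) (z : addr) : heap :=
  let s := children (store H z) in
  let H1 := foldl (fun H' x => upd H' x (with_parent None)) H s in
  with_nodes (nodes H `\ z) (with_roots (rem z (roots H) ++ s) H1).

Inductive extract_min (D : nat -> nat) (H : heap) :
  addr -> heap -> nat -> Prop :=
| ExtractLast z :
    hmin H = Some z ->
    roots (remove_min H z) = [::] ->
    extract_min D H z
      (with_n (hn H).-1 (with_min None (remove_min H z)))
      (1 + size (children (store H z)))
| ExtractConsolidate z H' c :
    hmin H = Some z ->
    roots (remove_min H z) <> [::] ->
    consolidate D (remove_min H z) H' c ->
    extract_min D H z (with_n (hn H').-1 H')
      (1 + size (children (store H z)) + c).

(* The adaptive Fibonacci heaps are the heaps built by the operations. *)
Inductive adaptive_heap (D : nat -> nat) : heap -> Prop :=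
| AdaptiveMake M : adaptive_heap D (make_heap M)
| AdaptiveInsert H x k :
    adaptive_heap D H -> x \notin nodes H ->
    adaptive_heap D (insert H x k).1
| AdaptiveUnion H1 H2 :
    adaptive_heap D H1 -> adaptive_heap D H2 ->
    [disjoint nodes H1 & nodes H2] ->
    adaptive_heap D (union H1 H2).1
| AdaptiveDecreaseKey H x k H' c :
    adaptive_heap D H -> x \in nodes H -> (k <= key (store H x))%O ->
    decrease_key H x k H' c ->
    adaptive_heap D H'
| AdaptiveExtractMin H z H' c :
    adaptive_heap D H -> extract_min D H z H' c ->
    adaptive_heap D H'.

End Heap.

Arguments node {disp} K.
Arguments heap {disp} K.

Section Bounds.
Local Open Scope ring_scope.
Context (R : realType).

Definition lg (x : R) : R := ln x / ln 2.

Definition golden_ratio : R := (1 + Num.sqrt 5) / 2.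

(* [floor (log_phi n)], the classical bound on the degrees of a Fibonacci heap
   with [n] nodes. *)
Definition degree_bound (n : nat) : nat :=
  Num.truncn (ln (n%:R : R) / ln golden_ratio).

(* [kappa] is the amount of work that one unit of potential pays for. *)
Definition amortized_cost (kappa : R) (c phi0 phi1 : nat) : R :=
  c%:R + kappa * (phi1%:R - phi0%:R).

End Bounds.

(* Main.v *)
(** Degrees are logarithmic because linking always makes a node of degree at
    least [i] the child of rank [i], and a non-root loses at most one child
    before it is cut: hence [i <= degree c_i + mark c_i] for the child [c_i] of
    rank [i], and a node of degree [k] has at least [phi ^ k] descendants.
    This survives CONSOLIDATE, although APPEND may link below a non-root,
    since a node stored in slot [d] has degree [d] or [d + 1].

    For the cost of CONSOLIDATE, every call of APPEND but the last of a chain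
    of recursive calls either removes a root, or moves a node out of a slot
    smaller than its degree. A slot only comes to hold such a node when a root
    is linked, so twice the number of roots plus the number of such slots pays
    for all the calls. *)

From mathcomp Require Import all_boot all_order all_algebra.
From mathcomp Require Import finmap.
From mathcomp Require Import reals exp.
From mathcomp Require Import zify lra.
Require Import Defs.

Set Implicit Arguments.
Unset Strict Implicit.
Unset Printing Implicit Defensive.

Import Order.TTheory GRing.Theory Num.Theory.

Local Open Scope fset_scope.
Local Open Scope nat_scope.

(** * Forest invariants, acyclicity and the growth of subtrees *)

Section Forest.
Context {disp : Order.disp_t} {K : orderType disp}.
Implicit Types (H : heap K) (N : {fset addr}) (st : addr -> node K).
Implicit Types (A : array) (x y z p : addr).

(** The main obstacle is that a call of APPEND has no invariant for the whole array: while it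
    recurses, slot [d] still holds the node being appended one slot higher, and it is overwritten
    only on return. Statements about APPEND therefore concern the slots from [d] on, with a frame
    condition for the other nodes; an invariant of the whole array is available only between two
    iterations of the scan.

    The operations are relations whose runs may get stuck, so a cost bound needs a companion saying
    that a run exists. For CONSOLIDATE this means that no degree outgrows the array in any
    intermediate heap; hence every single link has to preserve the full forest invariant, Fibonacci
    condition included.

    Potential is weighted by 4. In CONSOLIDATE a root carries two units for the link that may remove
    it and two for its visit, namely the loop iteration and the last call of its chain. The same
    weight pays for cascades: cutting a marked node costs two and lowers the potential by one. *)

Definition parent_rel st p x : Prop := parent (st x) = Some p.

(* [e] is the only node allowed to be one degree short of the Fibonacci
   condition: it has just lost a child and has not been marked or cut yet. *)
Record shape N st (e : option addr) : Prop := Shape {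
  shape_uniq : forall x, x \in N -> uniq (children (st x));
  shape_children : forall x y, x \in N ->
    (y \in children (st x)) = (y \in N) && (parent (st y) == Some x);
  shape_parent : forall x p, x \in N -> parent (st x) = Some p -> p \in N;
  shape_degree : forall x, x \in N -> degree (st x) = size (children (st x));
  shape_acc : forall x, x \in N -> Acc (parent_rel st) x;
  shape_fib : forall x i, x \in N -> i < size (children (st x)) ->
    let c := nth 0 (children (st x)) i in
    i <= degree (st c) + mark (st c) + (e == Some c)
}.

Definition ordered N st : Prop := forall x p,
  x \in N -> parent (st x) = Some p -> (key (st p) <= key (st x))%O.

Definition rootlist H : Prop :=
  uniq (roots H) /\
  forall x, (x \in roots H) = (x \in nodes H) && (parent (store H x) == None).

Definition forest H : Prop :=
  [/\ shape (nodes H) (store H) None, ordered (nodes H) (store H)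
    & rootlist H].

Definition min_ok H : Prop :=
  if hmin H is Some m then
    m \in roots H /\
    forall r, r \in roots H -> (key (store H m) <= key (store H r))%O
  else roots H = [::].

Definition well_formed H : Prop :=
  [/\ forest H, hn H = #|` nodes H| & min_ok H].

(** Acyclicity is stated as accessibility along parent pointers, and it survives any operation that
    only deletes pointers. The predicate [P] confines the comparison to live nodes, because the
    store is arbitrary elsewhere. *)
Lemma acc_parent_sub (P : addr -> Prop) st st' :
  (forall x p, P x -> parent (st' x) = Some p ->
     parent (st x) = Some p /\ P p) ->
  forall x, Acc (parent_rel st) x -> P x -> Acc (parent_rel st') x.
Proof.
move=> sub x; elim=> {}x _ IH Px; constructor=> p /(sub _ _ Px) [xp Pp].
exact: IH.
Qed.

Lemma exists_root_le N st x :
  (forall x p, x \in N -> parent (st x) = Some p -> p \in N) ->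
  ordered N st -> Acc (parent_rel st) x -> x \in N ->
  exists r, [/\ r \in N, parent (st r) = None
              & (key (st r) <= key (st x))%O].
Proof.
move=> Npar ord; elim=> {}x _ IH xN.
case xp: (parent (st x)) => [p|]; last by exists x.
have [r [rN rnone rle]] := IH p xp (Npar _ _ xN xp).
by exists r; split=> //; apply: le_trans rle (ord _ _ xN xp).
Qed.

Definition ancestor st n y : option addr :=
  iter n (obind (fun x => parent (st x))) (Some y).

Definition below st x y : Prop := exists n, ancestor st n y = Some x.

Lemma ancestorS st n y p :
  parent (st y) = Some p -> ancestor st n.+1 y = ancestor st n p.
Proof. by move=> yp; rewrite /ancestor iterSr /= yp. Qed.

(** A cycle through [x] is also a cycle of the same length through its parent, so accessibility
    induction rules it out. *)
Lemma acc_acyclic st x n :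
  Acc (parent_rel st) x -> ancestor st n.+1 x <> Some x.
Proof.
move=> acc; elim: acc n => {}x _ IH n xx.
case xp: (parent (st x)) => [p|]; last first.
  move: xx; rewrite /ancestor iterSr /= xp.
  by have -> : forall k, iter k (obind (fun x => parent (st x))) None = None
    by elim=> //= k ->.
apply: (IH p xp n); move: xx; rewrite (ancestorS _ xp) /ancestor /= => ->.
exact: xp.
Qed.

Lemma acc_parent_neq st x p :
  Acc (parent_rel st) x -> parent (st x) = Some p -> p != x.
Proof.
move=> acc xp; apply/eqP=> px; apply: (@acc_acyclic st x 0 acc).
by rewrite (ancestorS _ xp) px.
Qed.

(** The chain of ancestors of [y] is unique, so two distinct siblings on it would lie one properly
    above the other, which closes a cycle through their parent [v]. This makes the subtrees of
    siblings disjoint. *)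
Lemma below_sibling st v c d y :
  Acc (parent_rel st) v ->
  parent (st c) = Some v -> parent (st d) = Some v ->
  below st c y -> below st d y -> c = d.
Proof.
move=> acc cv dv [m ym] [n yn].
wlog le_mn : m n c d cv dv ym yn / m <= n.
  move=> th; case/orP: (leq_total m n) => [?|?]; first exact: (th m n).
  by apply/esym/(th n m).
move: yn; rewrite -(subnK le_mn) /ancestor iterD -/(ancestor _ _ _) ym.
case: (n - m) => [[->] //|k]; rewrite -/(ancestor _ _ _) (ancestorS _ cv).
move=> vk; case: (@acc_acyclic st v k acc).
by move: vk; rewrite /ancestor /= => ->.
Qed.

Section Size.
Context (R : realFieldType) (phi : R).
Hypotheses (phi2 : (phi ^+ 2 = phi + 1)%R) (phi_le2 : (phi <= 2)%R).

(* Two-step induction: the descendants through the first [k + 2] children are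
   those through the first [k + 1], plus the subtree of child [k + 1], which
   has degree at least [k]. *)
Lemma fib_descendants N st k v :
  shape N st None -> v \in N -> k <= degree (st v) ->
  exists s, [/\ uniq s, {subset s <= N}, (phi ^+ k <= (size s)%:R)%R &
    forall y, y \in s -> y = v \/
      exists2 i, i < k & below st (nth 0 (children (st v)) i) y].
Proof.
move=> shN.
have childP w i : w \in N -> i < degree (st w) ->
    let c := nth 0 (children (st w)) i in
    c \in N /\ parent (st c) = Some w.
  move=> wN; rewrite (shape_degree shN wN) => lt_i /=.
  have := mem_nth 0 lt_i.
  by rewrite (shape_children shN) // => /andP[-> /eqP ->].
suff: (forall v, v \in N -> k <= degree (st v) ->
  exists s, [/\ uniq s, {subset s <= N}, (phi ^+ k <= (size s)%:R)%R &
    forall y, y \in s -> y = v \/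
      exists2 i, i < k & below st (nth 0 (children (st v)) i) y]) /\
  (forall v, v \in N -> k.+1 <= degree (st v) ->
  exists s, [/\ uniq s, {subset s <= N}, (phi ^+ k.+1 <= (size s)%:R)%R &
    forall y, y \in s -> y = v \/
      exists2 i, i < k.+1 & below st (nth 0 (children (st v)) i) y]).
  by case=> h _; apply: h.
elim: k {v} => [|k [IH0 IH1]]; split=> //.
- move=> v vN _; exists [:: v]; split=> //; last by move=> y /[1!inE] /eqP; left.
  by move=> y /[1!inE] /eqP->.
(* Exponent 1: [v] and its first child are two nodes, which is where [phi <= 2] enters. *)
- move=> v vN lt0; have [cN cv] := childP v 0 vN lt0.
  set c := nth 0 _ 0 in cN cv *; exists [:: v; c]; split=> //.
  + rewrite /= inE andbT.
    exact: acc_parent_neq (shape_acc shN cN) cv.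
  + by move=> y /[!inE] /orP[] /eqP->.
  + by move=> y /[!inE] /orP[] /eqP->; [left|right; exists 0 => //; exists 0].
move=> v vN lt_k; have [cN cv] := childP v k.+1 vN lt_k.
set c := nth 0 _ _ in cN cv.
have degc : k <= degree (st c).
  have := shape_fib shN vN (i := k.+1).
  rewrite -(shape_degree shN vN) -/c => /(_ lt_k).
  by case: (mark (st c)) => /=; lia.
have [s1 [u1 sub1 size1 in1]] := IH1 v vN (ltnW lt_k).
have [s2 [u2 sub2 size2 in2]] := IH0 c cN degc.
have accv := shape_acc shN vN.
have below_c y : y \in s2 -> below st c y.
  case/in2=> [->|[i lt_i [n yn]]]; first by exists 0.
  have [_ ip] := childP c i cN (leq_trans lt_i degc).
  by exists n.+1; move: yn; rewrite /ancestor /= => ->; exact: ip.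
exists (s1 ++ s2); split.
- rewrite cat_uniq u1 u2 andbT /=; apply/hasPn=> y /below_c cy.
  apply/negP=> /in1[yv|[i lt_i iy]].
    case: cy => n; rewrite yv => vn; apply: (@acc_acyclic st v n accv).
    by move: vn; rewrite /ancestor /= => ->.
  have lt_i' : i < degree (st v) by lia.
  have [iN iv] := childP v i vN lt_i'.
  have := below_sibling accv iv cv iy cy => /eqP.
  rewrite nth_uniq ?(shape_uniq shN) // -?(shape_degree shN) //; lia.
- by move=> y; rewrite mem_cat => /orP[/sub1|/sub2].
(* The equation of [phi] splits the power [k + 2] into the powers [k + 1] and [k], the bounds for
   [s1] and [s2]. *)
- rewrite size_cat natrD -addn2 exprD phi2 mulrDr mulr1 -exprSr.
  exact: lerD.
- move=> y; rewrite mem_cat => /orP[/in1[|[i ? ?]]|/below_c cy]; first by left.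
    by right; exists i => //; lia.
  by right; exists k.+1.
Qed.

Lemma phi_degree_le N st v :
  shape N st None -> v \in N -> (phi ^+ degree (st v) <= #|` N|%:R)%R.
Proof.
move=> shN vN.
have [s [us sub le_s _]] := fib_descendants shN vN (leqnn _).
by apply: le_trans le_s _; rewrite ler_nat; apply: uniq_leq_size.
Qed.

End Size.
End Forest.

(** * Effect of cuts, links, insertion, union and removal on the forest *)

Section Operations.
Context {disp : Order.disp_t} {K : orderType disp}.
Implicit Types (H : heap K) (N : {fset addr}) (st : addr -> node K).
Implicit Types (A : array) (x y z p : addr).

Definition marked H : nat := #|` [fset x in nodes H | mark (store H x)] |.

Lemma marked_change H H' x :
  nodes H' = nodes H -> x \in nodes H ->
  (forall y, y != x -> mark (store H' y) = mark (store H y)) ->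
  marked H' + mark (store H x) = marked H + mark (store H' x).
Proof.
move=> eqN xN same; rewrite /marked.
rewrite (cardfsD1 x) [in RHS](cardfsD1 x) !inE /= eqN xN /=.
suff -> : [fset y in nodes H | mark (store H' y)] `\ x
        = [fset y in nodes H | mark (store H y)] `\ x
  by rewrite addnAC [RHS]addnAC; congr addn; rewrite addnC.
apply/fsetP=> y; rewrite !inE /=.
by have [//|/same ->] := eqVneq y x.
Qed.

Lemma marked_le H H' :
  nodes H' `<=` nodes H -> (forall y, mark (store H' y) -> mark (store H y)) ->
  marked H' <= marked H.
Proof.
move=> /fsubsetP sub le; apply/fsubset_leq_card/fsubsetP=> y.
by rewrite !inE /= => /andP[/sub -> /le].
Qed.

(** Removing a child never raises the rank of another one, so the lower bounds on degrees by rank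
    survive a cut. *)
Lemma nth_rem (s : seq addr) x i :
  i < size (rem x s) ->
  exists j, [/\ i <= j, j < size s & nth 0 (rem x s) i = nth 0 s j].
Proof.
elim: s i => //= a s IH i; case: ifP => _ lt_i.
  by exists i.+1.
case: i lt_i => [|i] /= lt_i; first by exists 0.
by have [j [? ? ?]] := IH i lt_i; exists j.+1.
Qed.

Lemma cut_parent H x y z :
  parent (store (cut H x y) z) =
  if z == x then None else parent (store H z).
Proof. by rewrite /=; case: (z == x); case: (z == y). Qed.

Lemma cut_children H x y z :
  children (store (cut H x y) z) =
  if z == y then rem x (children (store H z)) else children (store H z).
Proof. by rewrite /=; case: (z == x); case: (z == y). Qed.

Lemma cut_degree H x y z :
  degree (store (cut H x y) z) =
  if z == y then (degree (store H z)).-1 else degree (store H z).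
Proof. by rewrite /=; case: (z == x); case: (z == y). Qed.

Lemma cut_mark H x y z :
  mark (store (cut H x y) z) =
  if z == x then false else mark (store H z).
Proof. by rewrite /=; case: (z == x); case: (z == y). Qed.

Lemma cut_key H x y z : key (store (cut H x y) z) = key (store H z).
Proof. by rewrite /=; case: (z == x); case: (z == y). Qed.

(** The exception moves up: once cut, [x] is nobody's child and its own deficit is no longer
    constrained, while [y] has just lost a degree. The case [e = None] is the first cut of
    DECREASE-KEY, [e = Some x] a cascading one. *)
Lemma cut_shape H x y e :
  shape (nodes H) (store H) e -> (e = None \/ e = Some x) ->
  x \in nodes H -> parent (store H x) = Some y ->
  shape (nodes H) (store (cut H x y)) (Some y).
Proof.
move=> shH eP xN xy.
have yN := shape_parent shH xN xy.
have xch : x \in children (store H y) by rewrite (shape_children shH) // xN xy /=.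
split.
- move=> z zN; rewrite cut_children; have := shape_uniq shH zN.
  by case: ifP => // _ /rem_uniq.
- move=> z w zN; rewrite cut_children cut_parent.
  have := shape_children shH w zN.
  have [->|nzy] := eqVneq z y; have [->|nwx] := eqVneq w x.
  + by rewrite mem_rem_uniq ?(shape_uniq shH) // !inE eqxx andbF.
  + by rewrite mem_rem_uniq ?(shape_uniq shH) // !inE nwx.
  + by rewrite xy => ->; rewrite andbF (inj_eq Some_inj) eq_sym (negPf nzy) andbF.
  + by [].
- move=> z p zN; rewrite cut_parent; case: ifP => // _.
  exact: (shape_parent shH).
- move=> z zN; rewrite cut_children cut_degree (shape_degree shH zN).
  by case: ifP => // /eqP ->; rewrite size_rem.
- move=> z zN.
  apply: (@acc_parent_sub _ _ xpredT (store H)) (shape_acc shH zN) isT.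
  by move=> w p _; rewrite cut_parent; case: ifP.
have fib c j z : z \in nodes H -> j < size (children (store H z)) ->
    nth 0 (children (store H z)) j = c -> c != x ->
    j <= degree (store (cut H x y) c) + mark (store (cut H x y) c)
         + (Some y == Some c).
  move=> zN lt_j ec ncx; have := shape_fib shH zN lt_j.
  rewrite /= ec cut_degree cut_mark (negPf ncx) (inj_eq Some_inj) [y == c]eq_sym.
  have -> : (e == Some c) = false.
    by case: eP => ->; rewrite // (inj_eq Some_inj) eq_sym (negPf ncx).
  by case: (c == y) => /=; lia.
move=> z i zN; rewrite cut_children; case: eqP => [-> |/eqP nzy] lt_i.
  have [j [le_ij lt_j ec]] := nth_rem lt_i.
  apply: leq_trans le_ij (fib _ _ _ yN lt_j _ _) => //.
  have := mem_nth 0 lt_i; rewrite mem_rem_uniq ?(shape_uniq shH) // !inE.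
  by case/andP.
apply: (fib _ _ _ zN lt_i erefl); apply: contraNneq nzy => cx.
have := mem_nth 0 lt_i; rewrite cx (shape_children shH) // xy => /andP[_].
by rewrite eq_sym.
Qed.

(** Order is not assumed at [x], whose key may have just been lowered; the cut deletes the only
    pointer that can violate it. *)
Lemma cut_ordered H x y N :
  (forall z p, z != x -> z \in N -> parent (store H z) = Some p ->
     (key (store H p) <= key (store H z))%O) ->
  ordered N (store (cut H x y)).
Proof.
move=> ord z p zN; rewrite cut_parent !cut_key; case: eqP => // /eqP nzx.
exact: ord.
Qed.

Lemma cut_rootlist H x y :
  rootlist H -> x \in nodes H -> parent (store H x) = Some y ->
  rootlist (cut H x y).
Proof.
move=> [uR inR] xN xy; split.
  by rewrite /= rcons_uniq uR inR xy andbF.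
move=> z; rewrite cut_parent mem_rcons inE inR.
by have [->|] := eqVneq z x; rewrite ?xN.
Qed.

(** A root occurs in no child list, so the exception granted to it is vacuous. *)
Lemma shape_root N st y :
  shape N st (Some y) -> parent (st y) = None -> shape N st None.
Proof.
move=> shN yr; case: (shN) => ? ch ? ? ? fib; split=> // x i xN lt_i.
have /= := fib x i xN lt_i; case: eqP => //= -[yc].
by have := mem_nth 0 lt_i; rewrite ch // -yc yr andbF.
Qed.

Lemma eq_acc st st' x :
  (forall y, parent (st' y) = parent (st y)) ->
  Acc (parent_rel st) x -> Acc (parent_rel st') x.
Proof.
move=> eqp acc; apply: (@acc_parent_sub _ _ xpredT st) acc isT => y p _.
by rewrite eqp.
Qed.

Lemma mark_shape H y :
  shape (nodes H) (store H) (Some y) -> mark (store H y) = false ->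
  shape (nodes H) (store (upd H y (with_mark true))) None.
Proof.
move=> shH my.
have eqp z : parent (store (upd H y (with_mark true)) z) = parent (store H z).
  by rewrite /=; case: eqP.
have eqc z : children (store (upd H y (with_mark true)) z) = children (store H z).
  by rewrite /=; case: eqP.
have eqd z : degree (store (upd H y (with_mark true)) z) = degree (store H z).
  by rewrite /=; case: eqP.
case: (shH) => ? ch ? ? ? fib; split.
- by move=> z; rewrite eqc; eauto.
- by move=> z w; rewrite eqc eqp; eauto.
- by move=> z p; rewrite eqp; eauto.
- by move=> z; rewrite eqc eqd; eauto.
- by move=> z zN; apply: eq_acc eqp _; eauto.
- move=> z i zN; rewrite eqc => lt_i; cbv zeta; rewrite eqd.
  have /= := fib z i zN lt_i; rewrite (inj_eq Some_inj) [y == _]eq_sym.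
  by case: eqP => [->|_] /=; rewrite ?my; lia.
Qed.

Lemma with_key_shape H x k e :
  shape (nodes H) (store H) e ->
  shape (nodes H) (store (upd H x (with_key k))) e.
Proof.
move=> shH.
have eqp z : parent (store (upd H x (with_key k)) z) = parent (store H z).
  by rewrite /=; case: eqP.
have eqc z : children (store (upd H x (with_key k)) z) = children (store H z).
  by rewrite /=; case: eqP.
have eqd z : degree (store (upd H x (with_key k)) z) = degree (store H z).
  by rewrite /=; case: eqP.
have eqm z : mark (store (upd H x (with_key k)) z) = mark (store H z).
  by rewrite /=; case: eqP.
case: (shH) => ? ch ? ? ? fib; split.
- by move=> z; rewrite eqc; eauto.
- by move=> z w; rewrite eqc eqp; eauto.
- by move=> z p; rewrite eqp; eauto.
- by move=> z; rewrite eqc eqd; eauto.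
- by move=> z zN; apply: eq_acc eqp _; eauto.
- by move=> z i zN; rewrite eqc => lt_i; cbv zeta; rewrite eqd eqm; apply: fib.
Qed.

Section Link.
Variables (H : heap K) (y x : addr).
Hypothesis yr : parent (store H y) = None.

Lemma link_nodes : nodes (link H y x) = nodes H.
Proof. by rewrite /link yr. Qed.

Lemma link_hn : hn (link H y x) = hn H.
Proof. by rewrite /link yr. Qed.

Lemma link_roots : roots (link H y x) = rem y (roots H).
Proof. by rewrite /link yr. Qed.

Lemma link_size_roots :
  y \in roots H -> (size (roots (link H y x))).+1 = size (roots H).
Proof. by move=> yR; rewrite link_roots size_rem //; case: (roots H) yR. Qed.

Lemma link_parent z :
  parent (store (link H y x) z) =
  if z == y then Some x else parent (store H z).
Proof. by rewrite /link yr /=; case: (z == y); case: (z == x). Qed.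

Lemma link_children z :
  children (store (link H y x) z) =
  if z == x then rcons (children (store H z)) y else children (store H z).
Proof. by rewrite /link yr /=; case: (z == y); case: (z == x). Qed.

Lemma link_degree z :
  degree (store (link H y x) z) =
  if z == x then (degree (store H z)).+1 else degree (store H z).
Proof. by rewrite /link yr /=; case: (z == y); case: (z == x). Qed.

Lemma link_mark z :
  mark (store (link H y x) z) =
  if z == y then false else mark (store H z).
Proof. by rewrite /link yr /=; case: (z == y); case: (z == x). Qed.

Lemma link_key z : key (store (link H y x) z) = key (store H z).
Proof. by rewrite /link yr /=; case: (z == y); case: (z == x). Qed.

(* A strict comparison keeps [x] out of the tree rooted at [y]. *)
Lemma link_forest :
  forest H -> y \in nodes H -> x \in nodes H -> y != x ->
  degree (store H x) <= degree (store H y) ->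
  (key (store H x) <= key (store H y))%O ->
  parent (store H x) = None \/ node_lt H x y ->
  forest (link H y x).
Proof.
move=> [shH ord [uR inR]] yN xN nyx le_deg le_key xr_or_lt.
have yRoot : y \in roots H by rewrite inR yN yr.
have accx : Acc (parent_rel (store (link H y x))) x.
  case: xr_or_lt => [xr|].
    by constructor=> p; rewrite /parent_rel link_parent eq_sym (negPf nyx) xr.
  (* Keys never increase on the way up, so all ancestors of [x] stay strictly smaller than [y], and
     the climb never meets the new pointer out of [y]. *)
  suff gen w : Acc (parent_rel (store H)) w -> w \in nodes H ->
      node_lt H w y -> Acc (parent_rel (store (link H y x))) w.
    exact: gen (shape_acc shH xN) xN.
  rewrite /node_lt; elim=> z _ IH zN lt_z.
  constructor=> p; rewrite /parent_rel link_parent.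
  case: eqP => [zy|_ zp]; first by rewrite zy ltxx in lt_z.
  apply: (IH p zp (shape_parent shH zN zp)).
  exact: le_lt_trans (ord _ _ zN zp) lt_z.
rewrite /forest link_nodes; split; last first.
- split; rewrite link_roots; first exact: rem_uniq.
  move=> z; rewrite link_nodes mem_rem_uniq // !inE inR link_parent.
  by have [->|] := eqVneq z y; rewrite ?andbF.
- move=> z p zN; rewrite link_parent !link_key.
  by case: eqP => [->|_]; [case=> <-|apply: ord].
split.
- move=> z zN; rewrite link_children; case: eqP => [->|_]; last exact: (shape_uniq shH).
  by rewrite rcons_uniq (shape_uniq shH) // (shape_children shH) // yr andbF.
- move=> z w zN; rewrite link_children link_parent.
  have := shape_children shH w zN.
  have [->|nzx] := eqVneq z x; have [->|nwy] := eqVneq w y.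
  + by rewrite mem_rcons inE eqxx yN eqxx.
  + by rewrite mem_rcons inE (negPf nwy).
  + by rewrite yr andbF => ->; rewrite (inj_eq Some_inj) eq_sym (negPf nzx) andbF.
  + by [].
- move=> z p zN; rewrite link_parent; case: eqP => [_ [<-] //|_].
  exact: (shape_parent shH).
- move=> z zN; rewrite link_children link_degree (shape_degree shH zN).
  by case: ifP => // _; rewrite size_rcons.
- move=> z zN; elim: (shape_acc shH zN) => {zN}z _ IH.
  constructor=> p; rewrite /parent_rel link_parent.
  by case: eqP => [_ [<-] //|_]; apply: IH.
have fib c j z : z \in nodes H -> j < size (children (store H z)) ->
    nth 0 (children (store H z)) j = c ->
    j <= degree (store (link H y x) c) + mark (store (link H y x) c)
         + (None == Some c).
  move=> zN lt_j ec; have := shape_fib shH zN lt_j; rewrite /= ec addn0.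
  (* Unmarking [y] cannot hurt the old ranks: as a root, [y] was in no child list. *)
  have ncy : c != y.
    apply: contraTneq (mem_nth 0 lt_j) => ecy.
    by rewrite ec ecy (shape_children shH) // yr andbF.
  rewrite link_degree link_mark (negPf ncy).
  by case: (c == x) => /=; lia.
move=> z i zN; rewrite link_children; case: eqP => [-> |/eqP nzx] lt_i; last first.
  exact: (fib _ _ _ zN lt_i).
move: lt_i; rewrite size_rcons nth_rcons ltnS; cbv zeta.
case: ltngtP => // [lt_i _|-> _]; first exact: (fib _ _ _ xN lt_i).
(* The new child receives the rank [degree (store H x)], which is at most its own degree, so it
   needs no mark. *)
rewrite link_degree (negPf nyx) -(shape_degree shH) //.
by rewrite -addnA (leq_trans le_deg) // leq_addr.
Qed.

End Link.

Lemma foldl_orphan H (s : seq addr) :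
  let H1 := foldl (fun H' x => upd H' x (with_parent None)) H s in
  [/\ nodes H1 = nodes H, hn H1 = hn H &
   forall z, store H1 z =
     if z \in s then with_parent None (store H z) else store H z].
Proof.
elim: s H => //= x s IH H.
have [-> -> e] := IH (upd H x (with_parent None)); split=> // z.
rewrite e inE /=; case: (z == x) => //=; by case: ifP.
Qed.

Section RemoveMin.
Variables (H : heap K) (z : addr).

Lemma remove_min_store w :
  store (remove_min H z) w =
  if w \in children (store H z) then with_parent None (store H w)
  else store H w.
Proof. by have [_ _ e] := foldl_orphan H (children (store H z)); exact: e. Qed.

Lemma remove_min_hn : hn (remove_min H z) = hn H.
Proof. by have [_ e _] := foldl_orphan H (children (store H z)); exact: e. Qed.

Lemma remove_min_parent w :
  parent (store (remove_min H z) w) =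
  if w \in children (store H z) then None else parent (store H w).
Proof. by rewrite remove_min_store; case: ifP. Qed.

Lemma remove_min_children w :
  children (store (remove_min H z) w) = children (store H w).
Proof. by rewrite remove_min_store; case: ifP. Qed.

Lemma remove_min_degree w :
  degree (store (remove_min H z) w) = degree (store H w).
Proof. by rewrite remove_min_store; case: ifP. Qed.

Lemma remove_min_mark w :
  mark (store (remove_min H z) w) = mark (store H w).
Proof. by rewrite remove_min_store; case: ifP. Qed.

Lemma remove_min_key w :
  key (store (remove_min H z) w) = key (store H w).
Proof. by rewrite remove_min_store; case: ifP. Qed.

(** The promoted children keep their marks. This is harmless, since the Fibonacci condition speaks
    only of nodes in a child list, and the list of [z] disappears with [z]. *)
Lemma remove_min_forest :
  forest H -> z \in roots H -> forest (remove_min H z).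
Proof.
move=> [shH ord [uR inR]] zR.
have /andP[zN /eqP zr] : (z \in nodes H) && (parent (store H z) == None).
  by rewrite -inR.
have inch w : w \in nodes H ->
    (w \in children (store H z)) = (parent (store H w) == Some z).
  by move=> wN; rewrite (shape_children shH) // wN.
(* A remaining pointer is an old one that does not lead to [z], so it stays among the remaining
   nodes. *)
have parentP w p : w \in nodes (remove_min H z) ->
    parent (store (remove_min H z) w) = Some p ->
    parent (store H w) = Some p /\ p \in nodes (remove_min H z).
  rewrite !inE remove_min_parent => /andP[nwz wN].
  rewrite inch //; case: eqP => // nwp wp; split=> //.
  rewrite (shape_parent shH wN wp) andbT.
  by apply/eqP=> pz; apply: nwp; rewrite wp pz.
split; last first.
- split=> /=.
    rewrite cat_uniq rem_uniq // (shape_uniq shH) // andbT /=.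
    apply/hasPn=> w; rewrite (shape_children shH) // => /andP[_ /eqP wz].
    by apply/negP=> /mem_rem; rewrite inR wz andbF.
  move=> w; rewrite remove_min_parent mem_cat mem_rem_uniq // !inE inR.
  rewrite (shape_children shH) //.
  have [->|nwz] /= := eqVneq w z; first by rewrite zr andbF.
  case: (w \in nodes H) => //=.
  by case: (parent (store H w) =P Some z) => [->|_] //=; rewrite orbF.
- move=> w p wN /(parentP _ _ wN)[wp _]; rewrite !remove_min_key.
  by apply: ord wp; move: wN; rewrite !inE => /andP[].
split.
- move=> w; rewrite !inE remove_min_children => /andP[_].
  exact: (shape_uniq shH).
- move=> w v; rewrite !inE remove_min_children remove_min_parent => /andP[nwz wN].
  rewrite !(shape_children shH) //.
  have [->|nvz] /= := eqVneq v z; first by rewrite zr andbF.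
  case: (v \in nodes H) => //=.
  case: (parent (store H v) =P Some z) => [->|//].
  by rewrite (inj_eq Some_inj) eq_sym (negPf nwz).
- by move=> w p wN /(parentP _ _ wN)[].
- move=> w; rewrite !inE remove_min_children remove_min_degree => /andP[_].
  exact: (shape_degree shH).
- move=> w wN; have wN' : w \in nodes H by move: wN; rewrite !inE => /andP[].
  exact: (acc_parent_sub parentP (shape_acc shH wN') wN).
- move=> w i; rewrite !inE remove_min_children => /andP[_ wN] lt_i; cbv zeta.
  by rewrite remove_min_degree remove_min_mark; apply: (shape_fib shH).
Qed.

End RemoveMin.

Lemma insert_forest H x k :
  forest H -> x \notin nodes H -> forest (insert H x k).1.
Proof.
move=> [shH ord [uR inR]] xN.
set H' := (insert H x k).1.
have eqN : nodes H' = x |` nodes H.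
  by rewrite /H' /= /update_min; case: (hmin _) => [m|] //; case: ifP.
have eqR : roots H' = rcons (roots H) x.
  by rewrite /H' /= /update_min; case: (hmin _) => [m|] //; case: ifP.
have eqS w : store H' w = if w == x then Node k None [::] 0 false else store H w.
  by rewrite /H' /= /update_min; case: (hmin _) => [m|] //; case: ifP.
have old w : w \in nodes H -> store H' w = store H w.
  by move=> wN; rewrite eqS; case: eqP xN => // <-; rewrite wN.
have new : store H' x = Node k None [::] 0 false by rewrite eqS eqxx.
split; last first.
- split; rewrite eqR ?rcons_uniq ?uR ?andbT ?inR ?(negPf xN) // => w.
  rewrite mem_rcons inE eqN !inE inR.
  by have [->|nwx] /= := eqVneq w x; rewrite ?new // eqS (negPf nwx).
- move=> w p; rewrite eqN !inE => /orP[/eqP->|wN]; first by rewrite new.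
  by rewrite old // => wp; rewrite old ?(shape_parent shH wN wp) //; apply: ord.
rewrite eqN; split.
- move=> w /fset1UP[->|wN]; first by rewrite new.
  by rewrite old ?(shape_uniq shH).
- move=> w v /fset1UP[->|wN]; rewrite !inE.
    rewrite new /= in_nil; have [->|nvx] /= := eqVneq v x; first by rewrite new.
    apply/esym/negbTE/negP=> /andP[vN]; rewrite old // => /eqP vx.
    by rewrite (shape_parent shH vN vx) in xN.
  rewrite old // (shape_children shH) //.
  have [->|nvx] /= := eqVneq v x; first by rewrite new (negPf xN).
  by rewrite eqS (negPf nvx).
- move=> w p /fset1UP[->|wN]; first by rewrite new.
  by rewrite old // => /(shape_parent shH wN) pN; rewrite !inE pN orbT.
- move=> w /fset1UP[->|wN]; first by rewrite new.
  by rewrite old ?(shape_degree shH).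
- move=> w /fset1UP[->|wN].
    by constructor=> p; rewrite /parent_rel new.
  apply: (@acc_parent_sub _ _ (fun v => v \in nodes H) (store H)) (shape_acc shH wN) wN.
  by move=> v p /= vN; rewrite old // => vp; rewrite (shape_parent shH vN vp).
- move=> w i /fset1UP[->|wN]; first by rewrite new.
  rewrite old // => lt_i; cbv zeta; have := mem_nth 0 lt_i.
  rewrite (shape_children shH) // => /andP[cN _]; rewrite old //.
  exact: (shape_fib shH).
Qed.

Lemma union_forest (H1 H2 : heap K) :
  forest H1 -> forest H2 -> [disjoint nodes H1 & nodes H2] ->
  forest (union H1 H2).1.
Proof.
move=> [sh1 ord1 [uR1 inR1]] [sh2 ord2 [uR2 inR2]] /fdisjointP dis.
set H' := (union H1 H2).1.
have st1 w : w \in nodes H1 -> store H' w = store H1 w by move=> /= ->.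
have st2 w : w \in nodes H2 -> store H' w = store H2 w.
  by move=> wN /=; case: ifP => // /dis; rewrite wN.
have dis2 w : w \in nodes H2 -> w \in nodes H1 = false.
  by move=> wN; apply/negbTE/negP=> /dis; rewrite wN.
have eqN : nodes H' = nodes H1 `|` nodes H2 by [].
split; last first.
- split=> /=.
    rewrite cat_uniq uR1 uR2 andbT /=; apply/hasPn=> w.
    by rewrite inR2 inR1 => /andP[/dis2 ->].
  move=> w; rewrite mem_cat inR1 inR2 !inE.
  case: ifP => [w1|_] /=; first by rewrite (negPf (dis _ w1)) orbF.
  by [].
- move=> w p; rewrite eqN => /fsetUP[wN|wN].
    by rewrite st1 // => wp; rewrite st1 ?(shape_parent sh1 wN wp) //; apply: ord1.
  by rewrite st2 // => wp; rewrite st2 ?(shape_parent sh2 wN wp) //; apply: ord2.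
rewrite eqN; split.
- move=> w /fsetUP[wN|wN]; first by rewrite st1 ?(shape_uniq sh1).
  by rewrite st2 ?(shape_uniq sh2).
- move=> w v /fsetUP[wN|wN]; rewrite !inE.
    rewrite st1 // (shape_children sh1) //.
    have [v1|v1] /= := boolP (v \in nodes H1); first by rewrite v1.
    rewrite (negPf v1); apply/esym/negbTE/negP=> /andP[v2 /eqP vw].
    by have /dis2 := shape_parent sh2 v2 vw; rewrite wN.
  rewrite st2 // (shape_children sh2) // orbC.
  have [v2|v2] /= := boolP (v \in nodes H2); first by rewrite (dis2 _ v2).
  apply/esym/negbTE/negP=> /andP[v1]; rewrite v1 => /eqP vw.
  by have := shape_parent sh1 v1 vw; rewrite dis2.
- move=> w p /fsetUP[wN|wN].
    by rewrite st1 // => /(shape_parent sh1 wN) pN; rewrite !inE pN.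
  by rewrite st2 // => /(shape_parent sh2 wN) pN; rewrite !inE pN orbT.
- move=> w /fsetUP[wN|wN]; first by rewrite st1 ?(shape_degree sh1).
  by rewrite st2 ?(shape_degree sh2).
- move=> w /fsetUP[wN|wN].
    apply: (@acc_parent_sub _ _ (fun v => v \in nodes H1) (store H1)) (shape_acc sh1 wN) wN.
    by move=> v p /= vN; rewrite vN => vp; rewrite (shape_parent sh1 vN vp).
  apply: (@acc_parent_sub _ _ (fun v => v \in nodes H2) (store H2)) (shape_acc sh2 wN) wN.
  by move=> v p /= vN; rewrite dis2 // => vp; rewrite (shape_parent sh2 vN vp).
- move=> w i /fsetUP[wN|wN].
    rewrite st1 // => lt_i; cbv zeta; have := mem_nth 0 lt_i.
    rewrite (shape_children sh1) // => /andP[cN _]; rewrite st1 //.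
    exact: (shape_fib sh1).
  rewrite st2 // => lt_i; cbv zeta; have := mem_nth 0 lt_i.
  rewrite (shape_children sh2) // => /andP[cN _]; rewrite st2 //.
  exact: (shape_fib sh2).
Qed.

End Operations.

(** * Invariants, cost and termination of APPEND *)

Section Append.
Context {disp : Order.disp_t} {K : orderType disp}.
Implicit Types (H : heap K) (A : array) (x y z p : addr).

Definition held A d y : Prop := exists2 i, d <= i & nth None A i = Some y.

Record slots H A d : Prop := Slots {
  slots_nodes : forall y, held A d y -> y \in nodes H;
  slots_degree : forall i y, d <= i -> nth None A i = Some y ->
    i <= degree (store H y) <= i.+1;
  slots_inj : forall i j y, d <= i -> d <= j ->
    nth None A i = Some y -> nth None A j = Some y -> i = j
}.

Definition slot_surplus H (e : option addr) i : nat :=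
  if e is Some y then degree (store H y) != i else false.

(* The slots holding a node that gained a child without moving up: these pay
   for the recursive calls of [append] that do not link. *)
Definition surplus H A d : nat :=
  \sum_(d <= i < size A) slot_surplus H (nth None A i) i.

Lemma held_leq A d d' y : d' <= d -> held A d y -> held A d' y.
Proof. by move=> le_d [i le_i iy]; exists i => //; apply: leq_trans le_i. Qed.

Lemma eq_slots H H' A A' d :
  slots H A d -> nodes H' = nodes H ->
  (forall y, held A d y -> degree (store H' y) = degree (store H y)) ->
  (forall i, d <= i -> nth None A' i = nth None A i) ->
  slots H' A' d.
Proof.
case=> sN sd sinj eqN eqd eqA; split.
- by move=> y [i le_i]; rewrite eqA // eqN => iy; apply: sN; exists i.
- move=> i y le_i; rewrite eqA // => iy; rewrite eqd; first exact: sd.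
  by exists i.
- by move=> i j y le_i le_j; rewrite !eqA //; apply: sinj.
Qed.

Lemma slots_leq H A d d' : d <= d' -> slots H A d -> slots H A d'.
Proof.
move=> le_d [sN sd sinj]; split.
- by move=> y /(held_leq le_d); apply: sN.
- by move=> i y le_i; apply: sd; lia.
- by move=> i j y le_i le_j; apply: sinj; lia.
Qed.

Lemma eq_surplus H H' A A' d :
  size A' = size A ->
  (forall y, held A d y -> degree (store H' y) = degree (store H y)) ->
  (forall i, d <= i -> nth None A' i = nth None A i) ->
  surplus H' A' d = surplus H A d.
Proof.
move=> eqs eqd eqA; rewrite /surplus eqs; apply: eq_big_nat => i /andP[le_i _].
rewrite eqA // /slot_surplus; case iy: (nth None A i) => [y|//].
by rewrite eqd //; exists i.
Qed.

Lemma surplus_ltn H A d : d < size A ->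
  surplus H A d = slot_surplus H (nth None A d) d + surplus H A d.+1.
Proof. exact: big_ltn. Qed.

Record append_pre H A x d : Prop := AppendPre {
  pre_forest : forest H;
  pre_node : x \in nodes H;
  pre_root : parent (store H x) = None;
  pre_degree : degree (store H x) = d;
  pre_slots : slots H A d;
  pre_held : ~ held A d x
}.

(** By [post_roots], a node handled by the call either has acquired a parent or is still in a slot,
    so no root gets lost. In [post_cost] a root is worth two units and a surplus slot one; the final
    unit pays for the last call of the chain. *)
Record append_post H A x d H' A' (c : nat) : Prop := AppendPost {
  post_nodes : nodes H' = nodes H;
  post_hn : hn H' = hn H;
  post_forest : forest H';
  post_size : size A' = size A;
  post_low : forall i, i < d -> nth None A' i = nth None A i;
  post_slots : slots H' A' d;
  post_held : forall y, held A' d y -> y = x \/ held A d y;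
  post_frame : forall y, y <> x -> ~ held A d y ->
    degree (store H' y) = degree (store H y) /\
    parent (store H' y) = parent (store H y);
  post_roots : forall y, y = x \/ held A d y ->
    parent (store H' y) = None -> held A' d y;
  post_mark : forall y, mark (store H' y) -> mark (store H y);
  post_cost : c + 2 * size (roots H') + surplus H' A' d
              <= 2 * size (roots H) + surplus H A d + 1
}.

(** Factors out the write of [x] into slot [d] that ends every rule. Each rule then only has to
    describe the slots above [d], and the surplus of slot [d] is decided by the final degree of
    [x]. *)
Lemma append_store_slot H A x d H' A' c :
  append_pre H A x d -> d < size A ->
  nodes H' = nodes H -> hn H' = hn H -> forest H' -> size A' = size A ->
  (forall i, i < d -> nth None A' i = nth None A i) ->
  slots H' A' d.+1 ->
  (forall y, held A' d.+1 y -> held A d y) ->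
  d <= degree (store H' x) <= d.+1 ->
  (forall y, y <> x -> ~ held A d y ->
    degree (store H' y) = degree (store H y) /\
    parent (store H' y) = parent (store H y)) ->
  (forall y, held A d y -> parent (store H' y) = None -> held A' d.+1 y) ->
  (forall y, mark (store H' y) -> mark (store H y)) ->
  c + 2 * size (roots H') + surplus H' A' d.+1 + (degree (store H' x) != d)
    <= 2 * size (roots H) + surplus H A d + 1 ->
  append_post H A x d H' (set_nth None A' d (Some x)) c.
Proof.
move=> [_ xN _ _ _ xA] lt_d eqN eqn fH' eqs low [sN sd sinj] sub degx frame rts mk cost.
have nthE i : nth None (set_nth None A' d (Some x)) i =
              if i == d then Some x else nth None A' i.
  by rewrite nth_set_nth.
have high i : d.+1 <= i -> nth None (set_nth None A' d (Some x)) i = nth None A' i.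
  by rewrite nthE; case: eqP => // ->; rewrite ltnn.
have sizeE : size (set_nth None A' d (Some x)) = size A.
  by rewrite size_set_nth eqs; apply/maxn_idPr.
have heldE y : held (set_nth None A' d (Some x)) d y -> y = x \/ held A' d.+1 y.
  case=> i le_i; rewrite nthE; case: eqP => [_ [->]|nid iy]; first by left.
  by right; exists i => //; lia.
have xA' : ~ held A' d.+1 x by move=> /sub.
split=> //.
- by move=> i lt_i; rewrite nthE; case: eqP => [ei|_]; [lia|apply: low].
- split.
  + by move=> y /heldE[->|/sN //]; rewrite eqN.
  + move=> i y le_i; rewrite nthE; case: eqP => [-> [<-] //|nid].
    by apply: sd; lia.
  + move=> i j y le_i le_j; rewrite !nthE.
    case: eqP => [->|nid]; case: eqP => [->|njd] //.
    * by move=> [<-] jx; case: xA'; exists j => //; lia.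
    * by move=> ix [yx]; case: xA'; exists i => //; [lia|rewrite yx].
    * by apply: sinj; lia.
- by move=> y /heldE[|/sub]; [left|right].
- move=> y [->|/rts h] yr; first by exists d; rewrite // nthE eqxx.
  have [i le_i iy] := h yr; exists i; first by lia.
  by rewrite high.
- rewrite surplus_ltn ?sizeE // nthE eqxx.
  rewrite (@eq_surplus H' H' A') ?sizeE ?eqs //.
  by move: cost; rewrite /slot_surplus; lia.
Qed.

Section Step.
Variables (H : heap K) (A : array) (x : addr) (d : nat) (y : addr).
Hypotheses (pre : append_pre H A x d) (Ad : nth None A d = Some y).

Lemma slot_neq : y <> x.
Proof. by move=> yx; apply: (pre_held pre); exists d => //; rewrite -yx. Qed.

Lemma slot_node : y \in nodes H.
Proof. by apply: (slots_nodes (pre_slots pre)); exists d. Qed.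

Lemma slot_above z : held A d z -> z = y \/ held A d.+1 z.
Proof.
case=> i le_i iz; case: (ltngtP i d) => [|lt_i|ei]; first by lia.
  by right; exists i.
by left; move: iz; rewrite ei Ad => -[].
Qed.

Lemma slot_not_above : ~ held A d.+1 y.
Proof.
case=> i le_i iy.
have := slots_inj (pre_slots pre) (ltnW le_i) (leqnn d) iy Ad; lia.
Qed.

(** The heap after the optional link of the branch [y < x], shared by the rule that recurses and the
    one that stops. *)
Let H1 := if degree (store H y) == d then link H x y else H.

Lemma lt_step_nodes : nodes H1 = nodes H.
Proof. by rewrite /H1; case: ifP => // _; rewrite link_nodes ?(pre_root pre). Qed.

Lemma lt_step_hn : hn H1 = hn H.
Proof. by rewrite /H1; case: ifP => // _; rewrite link_hn ?(pre_root pre). Qed.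

(** A node in slot [d] has degree [d], and then gains [x], or [d + 1] already. Either way [y] ends
    with degree [d + 1], so a recursive call moves up by exactly one slot. *)
Lemma lt_step_degree z :
  degree (store H1 z) = if z == y then d.+1 else degree (store H z).
Proof.
have := slots_degree (pre_slots pre) (leqnn d) Ad; rewrite /H1.
case: ifP => [/eqP dy|/eqP ndy] rng.
  rewrite link_degree ?(pre_root pre) //.
  by case: eqP => // ->; rewrite dy.
by case: eqP => // ->; lia.
Qed.

Lemma lt_step_parent z : z <> x -> parent (store H1 z) = parent (store H z).
Proof.
move=> /eqP nzx; rewrite /H1; case: ifP => // _.
by rewrite link_parent ?(pre_root pre) // (negPf nzx).
Qed.

Lemma lt_step_mark z : mark (store H1 z) -> mark (store H z).
Proof.
rewrite /H1; case: ifP => // _.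
by rewrite link_mark ?(pre_root pre) //; case: ifP.
Qed.

Lemma lt_step_roots :
  size (roots H1) + (degree (store H y) == d) = size (roots H).
Proof.
rewrite /H1; case: ifP => _; last by rewrite addn0.
have [_ _ [_ inR]] := pre_forest pre.
have xR : x \in roots H by rewrite inR (pre_node pre) (pre_root pre).
by rewrite addn1 link_size_roots // (pre_root pre).
Qed.

Lemma lt_step_forest : node_lt H y x -> forest H1.
Proof.
move=> lt_yx; rewrite /H1; case: ifP => [/eqP dy|_]; last exact: pre_forest pre.
apply: link_forest.
- exact: pre_root pre.
- exact: pre_forest pre.
- exact: pre_node pre.
- exact: slot_node.
- by apply/eqP=> xy; apply: slot_neq.
- by rewrite dy (pre_degree pre).
- exact: ltW.
- by right.
Qed.

Lemma lt_step_slots : slots H1 A d.+1.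
Proof.
apply: (eq_slots (slots_leq (leqnSn d) (pre_slots pre))) => //.
  exact: lt_step_nodes.
move=> z hz; rewrite lt_step_degree; case: eqP => // ezy.
by case: slot_not_above; rewrite -ezy.
Qed.

Lemma lt_step_surplus : surplus H1 A d.+1 = surplus H A d.+1.
Proof.
apply: eq_surplus => // z hz; rewrite lt_step_degree; case: eqP => // ezy.
by case: slot_not_above; rewrite -ezy.
Qed.

Lemma lt_step_pre :
  node_lt H y x -> parent (store H1 y) = None -> append_pre H1 A y d.+1.
Proof.
move=> lt_yx yr; split.
- exact: lt_step_forest.
- by rewrite lt_step_nodes; exact: slot_node.
- exact: yr.
- by rewrite lt_step_degree eqxx.
- exact: lt_step_slots.
- exact: slot_not_above.
Qed.

End Step.

Lemma append_spec H A x d H' A' c :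
  append H A x d H' A' c -> append_pre H A x d ->
  append_post H A x d H' A' c.
Proof.
elim=> {H A x d H' A' c}.
- move=> H A x d lt_d Ad pre.
  have none y : held A d y -> held A d.+1 y.
    case=> i le_i iy; exists i => //.
    by case: (ltngtP i d) => [|//|ei]; [lia|rewrite ei Ad in iy].
  apply: (append_store_slot pre lt_d).
  + by [].
  + by [].
  + exact: pre_forest pre.
  + by [].
  + by [].
  + exact: slots_leq (leqnSn d) (pre_slots pre).
  + by move=> y; apply: held_leq.
  + by rewrite (pre_degree pre) leqnn leqnSn.
  + by [].
  + by move=> y /none.
  + by [].
  + by rewrite (surplus_ltn _ lt_d) Ad (pre_degree pre) eqxx /=; lia.
- move=> H A x d y H' A' c lt_d Ad lt_yx H1 yr _ IH pre.
  have dy : degree (store H1 y) = d.+1.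
    by rewrite (lt_step_degree pre Ad) eqxx.
  have pre1 : append_pre H1 A y d.+1 := lt_step_pre pre Ad lt_yx yr.
  rewrite dy in IH.
  have [eqN eqn fH' eqs low sl hl frame rts mk cost] := IH pre1.
  have nyx := slot_neq pre Ad.
  have xA : ~ held A d.+1 x by move=> /(held_leq (leqnSn d)) /(pre_held pre).
  have [degx _] := frame x (not_eq_sym nyx) xA.
  have degx' : degree (store H' x) = d.
    rewrite degx (lt_step_degree pre Ad); case: eqP => [xy|_].
      by case: nyx.
    exact: pre_degree pre.
  apply: (append_store_slot pre lt_d).
  + by rewrite eqN; exact: lt_step_nodes pre.
  + by rewrite eqn; exact: lt_step_hn pre.
  + exact: fH'.
  + exact: eqs.
  + by move=> i lt_i; apply: low; lia.
  + exact: sl.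
  + by move=> z /hl[->|]; [exists d|apply: held_leq].
  + by rewrite degx' leqnn leqnSn.
  + move=> z nzx nzA.
    have nzy : z <> y by move=> zy; apply: nzA; rewrite zy; exists d.
    have [|-> ->] := frame z nzy; first by move=> /(held_leq (leqnSn d)).
    rewrite (lt_step_degree pre Ad) (lt_step_parent _ pre) //.
    by case: eqP.
  + by move=> z /(slot_above Ad) /rts.
  + by move=> z /mk /(lt_step_mark pre).
  (* A link frees the two units of the root [x], for the call and the link itself. Without a link,
     [y] of degree [d + 1] gives way in slot [d] to [x] of degree [d], and the lost surplus pays for
     the call. *)
  + move: cost; rewrite degx' eqxx (lt_step_surplus pre Ad).
    rewrite (surplus_ltn H lt_d) Ad /= -(lt_step_roots y pre) -/H1.
    by case: (_ == d) => /=; lia.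
- move=> H A x d y p lt_d Ad lt_yx H1 yp pre.
  have nyx := slot_neq pre Ad.
  have degx : degree (store H1 x) = d.
    rewrite (lt_step_degree pre Ad); case: eqP => [xy|_].
      by case: nyx.
    exact: pre_degree pre.
  apply: (append_store_slot pre lt_d).
  + exact: lt_step_nodes pre.
  + exact: lt_step_hn pre.
  + exact: lt_step_forest pre Ad lt_yx.
  + by [].
  + by [].
  + exact: lt_step_slots pre Ad.
  + by move=> z; apply: held_leq.
  + by rewrite degx leqnn leqnSn.
  + move=> z nzx nzA.
    have nzy : z <> y by move=> zy; apply: nzA; rewrite zy; exists d.
    rewrite (lt_step_degree pre Ad) (lt_step_parent _ pre) //.
    by case: eqP.
  + by move=> z /(slot_above Ad) [->|//]; rewrite yp.
  + by move=> z /(lt_step_mark pre).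
  + rewrite degx eqxx (lt_step_surplus pre Ad).
    rewrite (surplus_ltn H lt_d) Ad /= -(lt_step_roots y pre) -/H1.
    by case: (_ == d) => /=; lia.
- move=> H A x d y lt_d Ad ge_yx pre.
  have nyx := slot_neq pre Ad.
  have yN := slot_node pre Ad.
  have yA := slot_not_above pre Ad.
  have [shH ord [uR inR]] := pre_forest pre.
  case yr: (parent (store H y)) => [p|].
    rewrite [Some p == None]/=; apply: (append_store_slot pre lt_d).
    + by [].
    + by [].
    + exact: pre_forest pre.
    + by [].
    + by [].
    + exact: slots_leq (leqnSn d) (pre_slots pre).
    + by move=> z; apply: held_leq.
    + by rewrite (pre_degree pre) leqnn leqnSn.
    + by [].
    + by move=> z /(slot_above Ad) [->|//]; rewrite yr.
    + by [].
    + rewrite (pre_degree pre) eqxx (surplus_ltn H lt_d) Ad /=; lia.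
  rewrite eqxx.
  have degz z : z <> x -> degree (store (link H y x) z) = degree (store H z).
    by move=> /eqP nzx; rewrite link_degree // (negPf nzx).
  have eqA z : held A d.+1 z -> degree (store (link H y x) z) = degree (store H z).
    move=> hz; apply: degz => zx; apply: (pre_held pre); rewrite -zx.
    exact: held_leq hz.
  have yR : y \in roots H by rewrite inR yN yr.
  apply: (append_store_slot pre lt_d).
  + by rewrite link_nodes.
  + by rewrite link_hn.
  + apply: link_forest => //; rewrite ?(pre_node pre) //.
    * exact/eqP.
    * rewrite (pre_degree pre).
      by have /andP[] := slots_degree (pre_slots pre) (leqnn d) Ad.
    * by rewrite leNgt.
    * by left; exact: pre_root pre.
  + by [].
  + by [].
  + apply: eq_slots (slots_leq (leqnSn d) (pre_slots pre)) _ _ _ => //.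
    by rewrite link_nodes.
  + by move=> z; apply: held_leq.
  + by rewrite link_degree // eqxx (pre_degree pre) leqnSn leqnn.
  + move=> z nzx nzA; rewrite degz // link_parent //; case: eqP => // zy.
    by case: nzA; rewrite zy; exists d.
  + by move=> z /(slot_above Ad) [->|//]; rewrite link_parent // eqxx.
  + by move=> z; rewrite link_mark //; case: ifP.
  (* The lost root [y] pays for the call and the link. The free unit of this last call is spent on
     the surplus that slot [d] acquires, as [x] now has degree [d + 1]. *)
  + rewrite (@eq_surplus H (link H y x) A) // (surplus_ltn H lt_d).
    rewrite link_degree // eqxx (pre_degree pre).
    by have := link_size_roots x yr yR; lia.
Qed.

(** Each recursive call climbs one slot, so [size A - d] decreases. The first hypothesis ranges over
    all forests on the same nodes because degrees must fit the array in every intermediate heap. *)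
Lemma append_exists H A x d :
  (forall H', forest H' -> nodes H' = nodes H ->
     forall y, y \in nodes H -> degree (store H' y) < size A) ->
  append_pre H A x d -> exists H' A' c, append H A x d H' A' c.
Proof.
have [n] := ubnP (size A - d).
elim: n H x d => // n IH H x d lt_n bnd pre.
have lt_d : d < size A.
  by rewrite -(pre_degree pre); apply: bnd; [exact: pre_forest pre| |exact: pre_node pre].
case Ad: (nth None A d) => [y|]; last by do 3 eexists; apply: AppendNil.
have [lt_yx|ge_yx] := boolP (node_lt H y x); last first.
  by do 3 eexists; apply: AppendGe Ad ge_yx.
pose H1 := if degree (store H y) == d then link H x y else H.
case yr: (parent (store H1 y)) => [p|].
  by do 3 eexists; apply: AppendLtNonroot Ad lt_yx yr.
have pre1 : append_pre H1 A y d.+1 := lt_step_pre pre Ad lt_yx yr.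
have dy := pre_degree pre1.
have [||H' [A' [c app]]] := IH H1 y d.+1 _ _ pre1; first by lia.
  by rewrite (lt_step_nodes y pre).
do 3 eexists; apply: AppendLtRoot Ad lt_yx yr _ => //.
by rewrite -/H1 dy; exact: app.
Qed.

End Append.

(** * The scan of CONSOLIDATE and the new root list *)

Section Consolidate.
Context {disp : Order.disp_t} {K : orderType disp}.
Implicit Types (H : heap K) (A : array) (s : seq addr) (x y z p : addr).

(** Between two iterations the whole array is meaningful, hence the index [0]. At the end, with [s]
    empty, [scan_roots] says that every root can be found in the array. *)
Record scan_inv H A s : Prop := ScanInv {
  scan_forest : forest H;
  scan_slots : slots H A 0;
  scan_uniq : uniq s;
  scan_todo : forall x, x \in s ->
    [/\ x \in nodes H, parent (store H x) = None & ~ held A 0 x];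
  scan_roots : forall y, y \in nodes H -> parent (store H y) = None ->
    held A 0 y \/ y \in s
}.

Lemma scan_append_pre H A x s :
  scan_inv H A (x :: s) -> append_pre H A x (degree (store H x)).
Proof.
move=> [fH sl _ todo _]; have [xN xr xA] := todo x (mem_head _ _).
split=> //; first exact: slots_leq sl.
by move=> /(held_leq (leq0n _)).
Qed.

(** A call at degree [d] changes the degrees of [x] and of nodes held from slot [d] on, at most.
    Since no node occupies two slots, the slots below [d] keep their nodes, degrees and surplus. *)
Lemma append_scan_inv H A x s H1 A1 c :
  scan_inv H A (x :: s) -> append H A x (degree (store H x)) H1 A1 c ->
  scan_inv H1 A1 s /\
  c + 2 * size (roots H1) + surplus H1 A1 0
    <= 2 * size (roots H) + surplus H A 0 + 1.
Proof.
move=> inv app; have pre := scan_append_pre inv.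
have lt_d : degree (store H x) < size A by case: app.
have [eqN eqn fH1 eqs low sl hl frame rts _ cost] := append_spec app pre.
case: inv => fH sl0 /= /andP[xs us] todo rts0.
set d := degree (store H x) in pre lt_d low sl hl frame rts cost *.
have [xN xr xA] := todo x (mem_head _ _).
have low_held i y : i < d -> nth None A i = Some y -> y <> x /\ ~ held A d y.
  move=> lt_i iy; split; first by move=> yx; apply: xA; exists i; rewrite -?yx.
  by case=> j le_j /(slots_inj sl0 (leq0n i) (leq0n j) iy); lia.
have low_degree i y : i < d -> nth None A i = Some y ->
    degree (store H1 y) = degree (store H y).
  by move=> lt_i /(low_held _ _ lt_i)[? ?]; case: (frame y).
have held0 y : held A1 0 y -> y = x \/ held A 0 y.
  case=> i _ iy; case: (ltnP i d) => [lt_i|ge_i].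
    by right; exists i; rewrite -?low.
  have [|->|hy] := hl y; [by exists i|by left|right; exact: held_leq hy].
split; last first.
  have le_d := ltnW lt_d.
  have cat G B : size B = size A -> surplus G B 0 =
      \sum_(0 <= i < d) slot_surplus G (nth None B i) i + surplus G B d.
    by move=> eqB; rewrite /surplus -big_cat_nat ?eqB.
  rewrite !cat //.
  suff -> : \sum_(0 <= i < d) slot_surplus H1 (nth None A1 i) i =
            \sum_(0 <= i < d) slot_surplus H (nth None A i) i by lia.
  apply: eq_big_nat => i /andP[_ lt_i]; rewrite low // /slot_surplus.
  by case iy: (nth None A i) => [y|//]; rewrite (low_degree i).
split=> //.
- split.
  + by move=> y /held0[->|/(slots_nodes sl0)]; rewrite eqN.
  + move=> i y _ iy; case: (ltnP i d) => [lt_i|ge_i].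
      move: iy; rewrite low // => iy; rewrite (low_degree i) //.
      exact: (slots_degree sl0 (leq0n i) iy).
    exact: (slots_degree sl ge_i iy).
  + have mixed i j y : i < d -> d <= j -> nth None A1 i = Some y ->
        nth None A1 j = Some y -> i = j.
      move=> lt_i le_j; rewrite low // => iy jy.
      have [nyx nyA] := low_held i y lt_i iy.
      by have [|//|//] := hl y; first by exists j.
    move=> i j y _ _ iy jy.
    case: (ltnP i d) => [lt_i|ge_i]; case: (ltnP j d) => [lt_j|ge_j].
    * by move: iy jy; rewrite !low //; apply: (slots_inj sl0).
    * exact: mixed iy jy.
    * by apply/esym/(mixed _ _ y).
    * exact: (slots_inj sl ge_i ge_j iy jy).
- move=> y ys; have [|yN yr yA] := todo y; first by rewrite inE ys orbT.
  have nyx : y <> x by move=> yx; rewrite -yx ys in xs.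
  have [|_ ->] := frame y nyx; first by move=> /(held_leq (leq0n _)).
  by rewrite eqN; split=> // /held0[].
- move=> y; rewrite eqN => yN yr.
  have [yx|nyx] := eqVneq y x.
    by left; apply: held_leq (rts _ (or_introl yx) yr).
  (* [held] is a proposition; a boolean search of the array from [d] on decides it. *)
  case e: (has (pred1 (Some y)) (drop d A)).
    move: e => /(has_nthP None)[i lt_i /eqP iy].
    left; apply: held_leq (leq0n d) (rts y _ yr); right.
    by exists (d + i); rewrite ?leq_addr // -nth_drop.
  have nyA : ~ held A d y.
    case=> i le_i iy; move/negbT: e => /hasPn /(_ (Some y)) /=.
    rewrite eqxx => h; apply: (negP (h _)) => //.
    have lt_i : i < size A by rewrite ltnNge; apply/negP=> /(nth_default None); rewrite iy.
    rewrite -iy -(subnKC le_i) -nth_drop; apply: mem_nth.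
    by rewrite size_drop ltn_sub2r // (leq_ltn_trans le_i).
  have [_ eqp] := frame y (elimN eqP nyx) nyA.
  have [|[i _ iy]|] := rts0 y yN; first by rewrite -eqp.
    left; exists i => //; rewrite low // ltnNge; apply/negP=> le_i.
    by apply: nyA; exists i.
  by rewrite inE (negPf nyx) /=; right.
Qed.

(** Every visited root adds two units: the loop iteration and the last call of its chain. *)
Lemma append_all_spec H A s H' A' c :
  append_all H A s H' A' c -> scan_inv H A s ->
  [/\ scan_inv H' A' [::], nodes H' = nodes H /\ hn H' = hn H, size A' = size A,
      forall y, mark (store H' y) -> mark (store H y)
    & c + 2 * size (roots H') + surplus H' A' 0
        <= 2 * size (roots H) + surplus H A 0 + 2 * size s].
Proof.
elim=> {H A s H' A' c} [H A inv|]; first by split=> //; lia.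
move=> H A x s H1 A1 c1 H2 A2 c2 app _ IH inv.
have post := append_spec app (scan_append_pre inv).
have [inv1 cost1] := append_scan_inv inv app.
have [inv2 [eqN eqn] eqs mk cost2] := IH inv1; split=> //.
- by rewrite eqN eqn (post_nodes post) (post_hn post).
- by rewrite eqs (post_size post).
- by move=> y /mk /(post_mark post).
- by rewrite /=; lia.
Qed.

Lemma append_all_exists H A s :
  (forall H', forest H' -> nodes H' = nodes H ->
     forall y, y \in nodes H -> degree (store H' y) < size A) ->
  scan_inv H A s -> exists H' A' c, append_all H A s H' A' c.
Proof.
elim: s H A => [|x s IH] H A bnd inv; first by do 3 eexists; constructor.
have pre := scan_append_pre inv.
have [H1 [A1 [c1 app]]] := append_exists bnd pre.
have post := append_spec app pre.
have [inv1 _] := append_scan_inv inv app.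
have [|H2 [A2 [c2 all2]]] := IH H1 A1 _ inv1.
  by rewrite (post_nodes post) (post_size post).
by do 3 eexists; apply: AppendAllCons app all2.
Qed.

Lemma scan_inv0 H n : forest H -> scan_inv H (nseq n None) (roots H).
Proof.
move=> fH; have [_ _ [uR inR]] := fH.
have none i : nth None (nseq n (None : option addr)) i = None.
  by rewrite nth_nseq; case: ifP.
split=> //.
- by split=> [y [i _]|i y _|i j y _ _]; rewrite none.
- move=> x; rewrite inR => /andP[-> /eqP ->]; split=> // -[i _].
  by rewrite none.
- by move=> y yN yr; right; rewrite inR yN yr.
Qed.

Lemma surplus_nseq H n : surplus H (nseq n None) 0 = 0.
Proof.
by rewrite /surplus big_nat big1 // => i _; rewrite nth_nseq if_same.
Qed.

Lemma update_min_nodes H x : nodes (update_min H x) = nodes H.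
Proof. by rewrite /update_min; case: hmin => [m|//]; case: ifP. Qed.

Lemma update_min_store H x : store (update_min H x) = store H.
Proof. by rewrite /update_min; case: hmin => [m|//]; case: ifP. Qed.

Lemma update_min_roots H x : roots (update_min H x) = roots H.
Proof. by rewrite /update_min; case: hmin => [m|//]; case: ifP. Qed.

Lemma update_min_hn H x : hn (update_min H x) = hn H.
Proof. by rewrite /update_min; case: hmin => [m|//]; case: ifP. Qed.

(** The old minimum need not be compared with [x], which is new or has a lowered key; [update_min]
    makes exactly that comparison. *)
Lemma update_min_ok H x :
  x \in roots H ->
  (forall m, hmin H = Some m -> m \in roots H /\
     forall r, r \in roots H -> r != x -> (key (store H m) <= key (store H r))%O) ->
  (hmin H = None -> roots H = [:: x]) ->
  min_ok (update_min H x).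
Proof.
move=> xR some none; rewrite /min_ok update_min_roots update_min_store.
rewrite /update_min; case hm: (hmin H) => [m|] /=; last first.
  by rewrite none //; split=> [|r]; rewrite inE // => /eqP ->.
have [mR mle] := some m hm.
rewrite /node_lt; case: ltP => [lt_xm|le_mx] /=; rewrite ?hm; split=> // r rR.
  have [->//|nrx] := eqVneq r x.
  exact: le_trans (ltW lt_xm) (mle r rR nrx).
by have [->//|nrx] := eqVneq r x; apply: mle.
Qed.

Definition root_slot H (e : option addr) : option addr :=
  if e is Some x then
    if parent (store H x) == None then Some x else None
  else None.

Lemma foldl_add_root H A :
  min_ok H ->
  let H' := foldl add_root H A in
  [/\ nodes H' = nodes H /\ hn H' = hn H, store H' = store H,
      roots H' = roots H ++ pmap (root_slot H) A & min_ok H'].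
Proof.
elim: A H => [|e A IH] H ok /=; first by rewrite cats0.
suff [eqN eqn eqS eqR ok1] : [/\ nodes (add_root H e) = nodes H,
    hn (add_root H e) = hn H, store (add_root H e) = store H,
    roots (add_root H e) = roots H ++ seq_of_opt (root_slot H e)
    & min_ok (add_root H e)].
  have [[-> ->] -> -> ok2] := IH _ ok1; split=> //.
  rewrite eqR -catA; congr (_ ++ _).
  have -> : root_slot (add_root H e) = root_slot H by rewrite /root_slot eqS.
  by case: (root_slot H e).
case: e => [x|] /=; last by rewrite cats0.
case: ifP => _ /=; last by rewrite cats0.
rewrite update_min_nodes update_min_store update_min_roots update_min_hn /=.
rewrite cats1; split=> //; apply: update_min_ok => /=.
- by rewrite mem_rcons mem_head.
- move=> m hm; move: ok; rewrite /min_ok hm => -[mR mle].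
  split; first by rewrite mem_rcons inE mR orbT.
  by move=> r; rewrite mem_rcons inE => /orP[->//|rR _]; apply: mle.
- by move=> hm; move: ok; rewrite /min_ok hm => ->.
Qed.

Lemma mem_root_slots H A y :
  (y \in pmap (root_slot H) A) <-> held A 0 y /\ parent (store H y) = None.
Proof.
rewrite mem_pmap; split.
  case/mapP=> -[x|//] /(nthP None)[i _ ix] /=.
  by case: eqP => // xr [->]; split=> //; exists i.
move=> [[i _ iy] yr]; apply/mapP; exists (Some y); last by rewrite /= yr.
rewrite -iy mem_nth // ltnNge; apply/negP=> /(nth_default None).
by rewrite iy.
Qed.

Lemma uniq_root_slots H A :
  (forall i j y, nth None A i = Some y -> nth None A j = Some y -> i = j) ->
  uniq (pmap (root_slot H) A).
Proof.
elim: A => //= e A IH inj.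
have uA : uniq (pmap (root_slot H) A).
  by apply: IH => i j y iy jy; have [] := inj i.+1 j.+1 y iy jy.
case: e inj => [x|] inj //=; case: ifP => //= _; rewrite uA andbT.
apply/negP=> /mem_root_slots[[i _ ix] _].
by have := inj 0 i.+1 x erefl ix.
Qed.

(** Every root sits in exactly one slot, so filtering the array recovers the set of roots without
    repetition. It also leaves at most one root per slot, which bounds the potential after
    CONSOLIDATE. *)
Lemma rebuild_forest H A :
  scan_inv H A [::] ->
  [/\ forest (rebuild H A), min_ok (rebuild H A),
      nodes (rebuild H A) = nodes H /\ hn (rebuild H A) = hn H,
      store (rebuild H A) = store H & size (roots (rebuild H A)) <= size A].
Proof.
move=> [[shH ord _] sl _ _ rts].
have [|[eqN eqn] eqS eqR ok] :=
  @foldl_add_root (with_min None (with_roots [::] H)) A.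
  by [].
rewrite -/(rebuild H A) in eqN eqn eqS eqR ok; split.
- rewrite /forest eqN eqS; split; [exact: shH|exact: ord|].
  split; rewrite eqR cat0s.
    by apply: uniq_root_slots => i j y; apply: (slots_inj sl).
  move=> x; rewrite eqN eqS; apply/idP/idP.
    by case/mem_root_slots=> /(slots_nodes sl) xN xr; rewrite xN xr.
  case/andP=> xN /eqP xr; apply/mem_root_slots; split; last exact: xr.
  by have [] := rts x xN xr.
- exact: ok.
- by rewrite eqN eqn.
- exact: eqS.
- by rewrite eqR cat0s size_pmap; apply: count_size.
Qed.

End Consolidate.

(** * Amortized cost of each operation on well-formed heaps *)

Section WellFormed.
Context {disp : Order.disp_t} {K : orderType disp}.
Implicit Types (H : heap K) (A : array) (x y z p : addr).

Lemma potentialE H : potential H = size (roots H) + 2 * marked H.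
Proof. by []. Qed.

Lemma well_formed_min H m :
  well_formed H -> hmin H = Some m ->
  [/\ m \in roots H, m \in nodes H &
   forall x, x \in nodes H -> (key (store H m) <= key (store H x))%O].
Proof.
move=> [[shH ord [_ inR]] _ ok] hm; move: ok; rewrite /min_ok hm => -[mR mle].
split=> //; first by move: mR; rewrite inR => /andP[].
move=> x xN; have parN := shape_parent shH.
have [r [rN rr rle]] := exists_root_le (@parN) ord (shape_acc shH xN) xN.
by apply: le_trans rle; apply: mle; rewrite inR rN rr.
Qed.

Lemma well_formed_hmin H :
  well_formed H -> nodes H != fset0 -> exists z, hmin H = Some z.
Proof.
move=> [[shH ord [_ inR]] _ ok] /fset0Pn[x xN].
case hm: (hmin H) => [z|]; first by exists z.
have parN := shape_parent shH.
have [r [rN rr _]] := exists_root_le (@parN) ord (shape_acc shH xN) xN.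
have : r \in roots H by rewrite inR rN rr.
by move: ok; rewrite /min_ok hm => ->.
Qed.

Lemma make_heap_well_formed (M : addr -> node K) : well_formed (make_heap M).
Proof.
split; [|by rewrite cardfs0|by []].
split; [|by move=> x p; rewrite inE|by split=> // x; rewrite !inE].
by split=> [x|x y|x p|x|x|x i]; rewrite inE.
Qed.

Lemma insert_well_formed H x k :
  well_formed H -> x \notin nodes H -> well_formed (insert H x k).1.
Proof.
move=> wf xN; have [fH hnE ok] := wf; have [shH ord [_ inR]] := fH.
split; first exact: insert_forest.
  by rewrite /= update_min_nodes cardfsU1 xN hnE.
set H2 := with_roots (rcons (roots H) x)
  (with_nodes (x |` nodes H) (upd H x (fun=> Node k None [::] 0 false))).
suff: min_ok (update_min H2 x) by [].
apply: update_min_ok; rewrite /H2 /=.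
- by rewrite mem_rcons mem_head.
- move=> m hm; have [mR mN mle] := well_formed_min wf hm.
  split; first by rewrite mem_rcons inE mR orbT.
  move=> r; rewrite mem_rcons inE => /orP[->//|rR nrx].
  have nmx : m != x by apply: contraNneq xN => <-.
  rewrite (negPf nmx) (negPf nrx); apply: mle.
  by move: rR; rewrite inR => /andP[].
- by move=> hm; move: ok; rewrite /min_ok hm => ->.
Qed.

(** The constant is one unit of work plus four for the new, unmarked root. *)
Lemma insert_potential H x k :
  x \notin nodes H ->
  (insert H x k).2 + 4 * potential (insert H x k).1 <= 4 * potential H + 5.
Proof.
move=> xN; rewrite !potentialE.
have -> : size (roots (insert H x k).1) = (size (roots H)).+1.
  by rewrite /= update_min_roots /= size_rcons.
suff : marked (insert H x k).1 <= marked H by rewrite /=; lia.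
apply/fsubset_leq_card/fsubsetP=> y.
rewrite /= update_min_nodes update_min_store !inE /=.
by case: eqP => //= _.
Qed.

Lemma union_well_formed (H1 H2 : heap K) :
  well_formed H1 -> well_formed H2 -> [disjoint nodes H1 & nodes H2] ->
  well_formed (union H1 H2).1.
Proof.
move=> wf1 wf2 dis; have [f1 hn1 ok1] := wf1; have [f2 hn2 ok2] := wf2.
have disP := fdisjointP dis.
split; first exact: union_forest.
  rewrite /= hn1 hn2 cardfsU.
  by move/eqP: dis => ->; rewrite cardfs0 subn0.
have [_ _ [_ inR1]] := f1; have [_ _ [_ inR2]] := f2.
set M := fun x => if x \in nodes H1 then store H1 x else store H2 x.
have M1 r : r \in roots H1 -> M r = store H1 r.
  by rewrite inR1 /M => /andP[->].
have M2 r : r \in roots H2 -> M r = store H2 r.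
  by rewrite inR2 /M => /andP[rN _]; case: ifP => // /disP; rewrite rN.
rewrite /min_ok /= -/M; move: ok1 ok2; rewrite /min_ok.
case: (hmin H1) => [m1|]; case: (hmin H2) => [m2|].
- move=> [m1R le1] [m2R le2].
  have le1' r : r \in roots H1 -> (key (M m1) <= key (M r))%O.
    by move=> rR; rewrite !M1 //; apply: le1.
  have le2' r : r \in roots H2 -> (key (M m2) <= key (M r))%O.
    by move=> rR; rewrite !M2 //; apply: le2.
  case: ltP => [lt21|le12]; split; rewrite ?mem_cat ?m1R ?m2R ?orbT // => r.
    rewrite mem_cat => /orP[/le1'|/le2' //]; exact: le_trans (ltW lt21).
  by rewrite mem_cat => /orP[/le1' //|/le2']; apply: le_trans.
- move=> [m1R le1] ->; rewrite cats0; split=> // r rR.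
  suff: (key (M m1) <= key (M r))%O by [].
  by rewrite !M1 //; apply: le1.
- move=> -> [m2R le2]; rewrite cat0s; split=> // r rR.
  suff: (key (M m2) <= key (M r))%O by [].
  by rewrite !M2 //; apply: le2.
- by move=> -> ->.
Qed.

Lemma union_potential (H1 H2 : heap K) :
  [disjoint nodes H1 & nodes H2] ->
  (union H1 H2).2 + 4 * potential (union H1 H2).1
    <= 4 * (potential H1 + potential H2) + 1.
Proof.
move=> /fdisjointP dis; rewrite !potentialE.
have -> : size (roots (union H1 H2).1) = size (roots H1) + size (roots H2).
  by rewrite /= size_cat.
suff : marked (union H1 H2).1 <= marked H1 + marked H2 by rewrite /=; lia.
apply: leq_trans (leq_subr #|` [fset x in nodes H1 | mark (store H1 x)]
  `&` [fset x in nodes H2 | mark (store H2 x)]| _).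
rewrite -cardfsU; apply/fsubset_leq_card/fsubsetP=> y; rewrite !inE /=.
by case: (y \in nodes H1) => //= ->.
Qed.

Lemma cut_marked H x y :
  x \in nodes H -> marked (cut H x y) + mark (store H x) = marked H.
Proof.
move=> xN; rewrite (@marked_change _ _ H (cut H x y) x) //.
  by rewrite cut_mark eqxx addn0.
by move=> z /negPf nzx; rewrite cut_mark nzx.
Qed.

Lemma cut_potential H x y :
  x \in nodes H ->
  potential (cut H x y) + 2 * mark (store H x) = (potential H).+1.
Proof.
move=> xN; rewrite !potentialE -(cut_marked y xN).
have -> : size (roots (cut H x y)) = (size (roots H)).+1 by rewrite /= size_rcons.
by lia.
Qed.

(** A cut of a marked node trades a mark, worth two, for a root, worth one; the four units so freed
    cover its cost of two. The [9] is the final marking: one unit of work and a potential increase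
    of two. *)
Lemma cascading_cut_spec H y H' c :
  cascading_cut H y H' c ->
  shape (nodes H) (store H) (Some y) -> ordered (nodes H) (store H) ->
  rootlist H -> y \in nodes H ->
  [/\ forest H', [/\ nodes H' = nodes H, hn H' = hn H & hmin H' = hmin H],
      forall z, key (store H' z) = key (store H z),
      {subset roots H <= roots H'}
    & c + 4 * potential H' <= 4 * potential H + 9].
Proof.
elim=> {H y H' c}.
- move=> H y yr shH ord rl yN; split; [|by []|by []|by []|by lia].
  by split; [exact: shape_root shH yr|exact: ord|exact: rl].
- move=> H y p yp my shH ord rl yN; split; [|by []| |by []|].
  + split.
    * exact: mark_shape shH my.
    * move=> z q zN /=; have := ord z q zN; by case: (z == y) => h /h; case: (q == y).
    * case: rl => uR inR; split=> // z; by rewrite inR /=; case: (z == y).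
  + by move=> z /=; case: eqP.
  + rewrite !potentialE.
    have := @marked_change _ _ H (upd H y (with_mark true)) y erefl yN.
    rewrite /= eqxx my /= => h.
    have : marked (upd H y (with_mark true)) + 0 = marked H + 1.
      by apply: h => z /negPf ->.
    by lia.
- move=> H y p H' c yp my _ IH shH ord rl yN.
  have pN := shape_parent shH yN yp.
  have [] := IH.
  + exact: cut_shape shH (or_intror erefl) yN yp.
  + by apply: cut_ordered => z q _; apply: ord.
  + exact: cut_rootlist.
  + exact: pN.
  move=> fH' [eqN eqn eqm] eqk sub cost; split; [by []|by []| | |].
  + by move=> z; rewrite eqk cut_key.
  + by move=> z zR; apply: sub; rewrite /= mem_rcons inE zR orbT.
  + by have := cut_potential p yN; rewrite my; lia.
Qed.

(** Every cut of the cascade unmarks a node, so the number of marked nodes decreases. *)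
Lemma cascading_cut_exists H y :
  shape (nodes H) (store H) (Some y) -> y \in nodes H ->
  exists H' c, cascading_cut H y H' c.
Proof.
have [n] := ubnP (marked H); elim: n H y => // n IH H y lt_n shH yN.
case yp: (parent (store H y)) => [p|]; last by do 2 eexists; apply: CascadeRoot.
case my: (mark (store H y)); last by do 2 eexists; apply: CascadeMark yp my.
have pN := shape_parent shH yN yp.
have [||H' [c casc]] := IH (cut H y p) p _ _ pN.
- by have := cut_marked p yN; rewrite my; lia.
- exact: cut_shape shH (or_intror erefl) yN yp.
by do 2 eexists; apply: CascadeCut yp my casc.
Qed.

Section DecreaseKey.
Variables (H : heap K) (x : addr) (k : K).
Hypotheses (wf : well_formed H) (xN : x \in nodes H).
Hypothesis le_k : (k <= key (store H x))%O.

Let H0 := upd H x (with_key k).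

Lemma lowered_parent z : parent (store H0 z) = parent (store H z).
Proof. by rewrite /=; case: eqP. Qed.

Lemma lowered_mark z : mark (store H0 z) = mark (store H z).
Proof. by rewrite /=; case: eqP. Qed.

Lemma lowered_key_le z : (key (store H0 z) <= key (store H z))%O.
Proof. by rewrite /=; case: eqP => // ->. Qed.

Lemma lowered_key z : z != x -> key (store H0 z) = key (store H z).
Proof. by rewrite /=; case: eqP. Qed.

Lemma lowered_shape : shape (nodes H) (store H0) None.
Proof. by have [[shH _ _] _ _] := wf; apply: with_key_shape. Qed.

Lemma lowered_rootlist : rootlist H0.
Proof.
have [[_ _ [uR inR]] _ _] := wf; split=> // z.
by rewrite lowered_parent /= inR.
Qed.

Lemma lowered_potential : potential H0 = potential H.
Proof.
rewrite !potentialE.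
have := @marked_change _ _ H H0 x erefl xN (fun z _ => lowered_mark z).
by rewrite lowered_mark => /addIn ->.
Qed.

Lemma lowered_order z p :
  z != x -> z \in nodes H -> parent (store H0 z) = Some p ->
  (key (store H0 p) <= key (store H0 z))%O.
Proof.
move=> nzx zN; rewrite lowered_parent => zp; rewrite (lowered_key nzx).
apply: le_trans (lowered_key_le p) _.
by have [[_ ord _] _ _] := wf; apply: ord zp.
Qed.

Lemma lowered_min m z :
  hmin H = Some m -> z \in nodes H -> z != x ->
  (key (store H0 m) <= key (store H0 z))%O.
Proof.
move=> hm zN nzx; rewrite (lowered_key nzx).
apply: le_trans (lowered_key_le m) _.
by have [_ _] := well_formed_min wf hm; apply.
Qed.

Lemma hmin_neq_None : hmin H <> None.
Proof.
have [|z -> //] := well_formed_hmin wf.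
by apply/fset0Pn; exists x.
Qed.

Lemma cut_lowered_pre y :
  parent (store H0 x) = Some y ->
  [/\ shape (nodes H) (store (cut H0 x y)) (Some y),
      ordered (nodes H) (store (cut H0 x y)),
      rootlist (cut H0 x y) & y \in nodes H].
Proof.
move=> xy; have sh0 := lowered_shape; split.
- exact: (@cut_shape _ _ H0 x y None sh0 (or_introl erefl)).
- by apply: cut_ordered => z p; apply: lowered_order.
- exact: (cut_rootlist lowered_rootlist).
- exact: (shape_parent sh0 xN).
Qed.

Lemma decrease_key_exists : exists H' c, decrease_key H x k H' c.
Proof.
case xp: (parent (store H0 x)) => [y|]; last first.
  by do 2 eexists; apply: DecreaseStay => y; rewrite -/H0 xp.
have [lt_xy|ge_xy] := boolP (node_lt H0 x y); last first.
  by do 2 eexists; apply: DecreaseStay => z; rewrite -/H0 xp => -[<-].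
have [shc _ _ yN] := cut_lowered_pre xp.
have [H1 [c casc]] := @cascading_cut_exists (cut H0 x y) y shc yN.
by do 2 eexists; apply: DecreaseCut xp lt_xy casc.
Qed.

(** In the cutting case, [15] is two units of work, four for the root that [x] becomes and nine for
    the cascade. *)
Lemma decrease_key_spec H' c :
  decrease_key H x k H' c ->
  well_formed H' /\ c + 4 * potential H' <= 4 * potential H + 15.
Proof.
have [[shH ord [uR inR]] hnE ok] := wf.
have potential_min (G : heap K) : potential (update_min G x) = potential G.
  rewrite !potentialE update_min_roots /marked.
  by rewrite update_min_nodes update_min_store.
case=> {H' c}.
- move=> G stay; rewrite /G -/H0 in stay *; split; last first.
    by rewrite potential_min lowered_potential; lia.
  have sh0 := lowered_shape; have rl0 := lowered_rootlist.
  have ord0 : ordered (nodes H0) (store H0).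
    move=> z p zN; have [->|nzx] := eqVneq z x; last exact: lowered_order.
    by move=> /stay; rewrite /node_lt -leNgt.
  split.
  + split; rewrite ?update_min_nodes ?update_min_store; [by []|by []|].
    case: rl0 => u0 in0; split; rewrite update_min_roots // => z.
    by rewrite in0 update_min_nodes update_min_store.
  + by rewrite update_min_hn update_min_nodes.
  case xp: (parent (store H0 x)) => [y|]; last first.
    have xR : x \in roots H0 by case: rl0 => _ ->; rewrite xp andbT.
    apply: update_min_ok => //; last by move=> /hmin_neq_None.
    move=> m hm; have [mR mN _] := well_formed_min wf hm; split=> // r rR nrx.
    by apply: lowered_min => //; move: rR; rewrite /= inR => /andP[].
  have xR r : r \in roots H -> r != x.
    by rewrite inR; apply: contraTneq => ->; rewrite -lowered_parent xp andbF.
  rewrite /min_ok update_min_roots update_min_store /update_min.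
  case hm: (hmin H0) => [m|]; last by case: hmin_neq_None.
  have [mR mN _] := well_formed_min wf hm.
  have lem r : r \in roots H -> (key (store H0 m) <= key (store H0 r))%O.
    move=> rR; apply: lowered_min => //; last exact: xR.
    by move: rR; rewrite inR => /andP[].
  (* Here [x] is not a root and must not become the minimum. Heap order still holds, so the root
     above [x] has a key at most that of [x], and the old minimum is at most that root. *)
  have -> : node_lt H0 x m = false.
    apply/negbTE; rewrite /node_lt -leNgt.
    have parN := shape_parent sh0.
    have [r [rN rr rle]] := exists_root_le (@parN) ord0 (shape_acc sh0 xN) xN.
    by apply: le_trans rle; apply: lem; rewrite inR rN -lowered_parent rr.
  by rewrite hm; split.
- move=> y H1 c G xp lt_xy casc; rewrite /G -/H0 in xp lt_xy casc.
  have [shc ordc rlc yN] := cut_lowered_pre xp.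
  have [fH1 [eqN eqn eqm] eqk sub cost] :=
    cascading_cut_spec casc shc ordc rlc yN.
  split; last first.
    have := @cut_potential H0 x y xN; rewrite lowered_potential.
    by rewrite potential_min; lia.
  have [sh1 ord1 [uR1 inR1]] := fH1.
  split.
  + split; rewrite ?update_min_nodes ?update_min_store; [by []|by []|].
    split; rewrite update_min_roots // => z.
    by rewrite inR1 update_min_nodes update_min_store.
  + by rewrite update_min_hn update_min_nodes eqN eqn.
  apply: update_min_ok.
  + by apply: sub; rewrite /= mem_rcons mem_head.
  + move=> m; rewrite eqm => hm; have [mR mN _] := well_formed_min wf hm.
    split; first by apply: sub; rewrite /= mem_rcons inE mR orbT.
    move=> r rR nrx; rewrite !eqk !cut_key; apply: lowered_min => //.
    by move: rR; rewrite inR1 eqN => /andP[].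
  + by rewrite eqm => /hmin_neq_None.
Qed.

End DecreaseKey.

Section ExtractMin.
Variable D : nat -> nat.
(** The number [n] may exceed the number of nodes, because CONSOLIDATE sizes its array by [hn],
    which still counts the removed minimum. *)
Hypothesis degree_le : forall H n x,
  forest H -> #|` nodes H| <= n -> x \in nodes H -> degree (store H x) <= D n.

Lemma extract_min_exists H :
  well_formed H -> nodes H != fset0 ->
  exists z H' c, extract_min D H z H' c.
Proof.
move=> wf ne; have [z hm] := well_formed_hmin wf ne.
have [fH hnE _] := wf; have [zR zN _] := well_formed_min wf hm.
have [rnil|rne] := altP (roots (remove_min H z) =P [::]).
  by do 3 eexists; apply: ExtractLast hm rnil.
have fM := remove_min_forest fH zR.
have [|H1 [A1 [c all1]]] := append_all_exists _ (scan_inv0 (D (hn H)).+1 fM).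
  move=> H' fH' eqN y yN; rewrite size_nseq ltnS; apply: degree_le => //.
    by rewrite eqN hnE; apply/fsubset_leq_card/fsubD1set.
  by rewrite eqN.
exists z; do 2 eexists; apply: ExtractConsolidate hm (elimN eqP rne) _.
by constructor; rewrite remove_min_hn; exact: all1.
Qed.

(** The slope is [11 = 1 + 2 + 4 + 4]: moving the children of [z], creating and scanning the array,
    the potential of the children as roots, and that of the at most [D + 1] final roots. The old
    roots pay for the rest up to a constant. *)
Lemma extract_min_spec H z H' c :
  well_formed H -> extract_min D H z H' c ->
  well_formed H' /\
  c + 4 * potential H' <= 4 * potential H + (11 * D #|` nodes H| + 7).
Proof.
move=> wf ext; have hm : hmin H = Some z by case: ext.
have [fH hnE _] := wf; have [zR zN _] := well_formed_min wf hm.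
have [shH _ _] := fH.
have fM := remove_min_forest fH zR.
have degz : size (children (store H z)) <= D #|` nodes H|.
  by rewrite -(shape_degree shH) //; apply: degree_le.
have rootsM : (size (roots (remove_min H z))).+1
    = size (roots H) + size (children (store H z)).
  rewrite /= size_cat -addSn size_rem //; congr (_ + _).
  by case: (roots H) zR.
have markM : marked (remove_min H z) <= marked H.
  apply: marked_le => [|y]; first exact: fsubD1set.
  by rewrite remove_min_mark.
have cardM : #|` nodes (remove_min H z)| = #|` nodes H|.-1.
  by rewrite /= (cardfsD1 z (nodes H)) zN.
have hnM : (hn H).-1 = #|` nodes (remove_min H z)| by rewrite hnE cardM.
destruct ext as [z _ rnil|z H' c _ _ cons].
  have [shM ordM rlM] := fM.
  split; first by split; [|exact: hnM|exact: rnil].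
  rewrite -[potential (with_n _ _)]/(potential (remove_min H z)) !potentialE.
  by rewrite rnil [size [::]]/=; lia.
case: cons => {H' c} H1 A1 c.
rewrite remove_min_hn => all1.
have [inv [eqN eqn] eqs mk cost] := append_all_spec all1 (scan_inv0 _ fM).
have [fR okR [eqNR eqnR] eqSR sizeR] := rebuild_forest inv.
split.
  split; [exact: fR| |exact: okR].
  by rewrite /= eqnR eqn eqNR eqN remove_min_hn hnM.
rewrite surplus_nseq eqs size_nseq in cost sizeR *.
have markR : marked (rebuild H1 A1) <= marked (remove_min H z).
  by apply: marked_le => [|y]; rewrite ?eqNR ?eqN // eqSR; apply: mk.
rewrite -[potential (with_n _ _)]/(potential (rebuild H1 A1)) !potentialE.
rewrite -hnE in degz *.
by lia.
Qed.

Lemma adaptive_heap_well_formed H : adaptive_heap D H -> well_formed H.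
Proof.
elim=> {H} [M|H x k _ wf xN|H1 H2 _ wf1 _ wf2 dis|H x k H' c _ wf xN le_k dk
           |H z H' c _ wf ext].
- exact: make_heap_well_formed.
- exact: insert_well_formed.
- exact: union_well_formed.
- by have [] := decrease_key_spec wf xN le_k dk.
- by have [] := extract_min_spec wf ext.
Qed.

End ExtractMin.
End WellFormed.

(** * The golden ratio and logarithmic bounds *)

Section GoldenRatio.
Local Open Scope ring_scope.
Context (R : realType).
Let phi : R := golden_ratio R.

Lemma sqr_sqrt5 : Num.sqrt (5 : R) ^+ 2 = 5.
Proof. by rewrite sqr_sqrtr. Qed.

Lemma golden_ratio_sqr : phi ^+ 2 = phi + 1.
Proof.
have := sqr_sqrt5; rewrite /phi /golden_ratio; set s := Num.sqrt _ => s2.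
nra.
Qed.

Lemma golden_ratio_gt1 : 1 < phi.
Proof.
have := sqr_sqrt5; have := sqrtr_ge0 (5 : R).
rewrite /phi /golden_ratio; set s := Num.sqrt _ => s0 s2.
have : 1 < s by rewrite ltNge; apply/negP=> s1; nra.
by lra.
Qed.

Lemma golden_ratio_le2 : phi <= 2.
Proof.
have := sqr_sqrt5; rewrite /phi /golden_ratio; set s := Num.sqrt _ => s2.
have : s <= 3 by rewrite leNgt; apply/negP=> s1; nra.
by lra.
Qed.

Lemma ln_golden_ratio_gt0 : 0 < ln phi.
Proof. by rewrite ln_gt0 // golden_ratio_gt1. Qed.

Lemma ln_nat_ge0 n : 0 <= ln (n%:R : R).
Proof.
(* By convention [ln 0 = 0], which covers [n = 0]. *)
by case: n => [|n]; [rewrite ln0|apply: ln_ge0; rewrite ler1n].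
Qed.

(** Taking logarithms in [phi ^+ d <= n] gives a real bound on the integer [d], which therefore
    survives truncation. *)
Lemma degree_le_bound disp (K : orderType disp) (H : heap K) n x :
  forest H -> (#|` nodes H| <= n)%N -> x \in nodes H ->
  (degree (store H x) <= degree_bound R n)%N.
Proof.
move=> [shH _ _] le_n xN.
have := phi_degree_le golden_ratio_sqr golden_ratio_le2 shH xN.
set d := degree _ => le_d.
have {le_n}le_d : phi ^+ d <= n%:R by apply: le_trans le_d _; rewrite ler_nat.
have phi0 : 0 < phi by apply: lt_trans golden_ratio_gt1.
have lnphi := ln_golden_ratio_gt0.
rewrite /degree_bound truncn_ge_nat; last first.
  by rewrite divr_ge0 ?ln_nat_ge0 // ltW.
rewrite ler_pdivlMr // mulr_natl -lnXn // ler_ln ?posrE ?exprn_gt0 //.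
by apply: lt_le_trans le_d; rewrite exprn_gt0.
Qed.

Lemma degree_bound_le n :
  (degree_bound R n)%:R <= ln 2 / ln phi * Num.max 1 (lg (n%:R : R)).
Proof.
have ln2 : 0 < ln (2 : R) by rewrite ln_gt0 // ltr1n.
have lnphi := ln_golden_ratio_gt0.
apply: (@le_trans _ _ (ln (n%:R : R) / ln phi)).
  by rewrite truncn_le // divr_ge0 ?ln_nat_ge0 // ltW.
have -> : ln (n%:R : R) / ln phi = ln 2 / ln phi * lg (n%:R : R).
  by rewrite /lg [RHS]mulrC mulrA divfK ?gt_eqF.
apply: ler_wpM2l; first by rewrite divr_ge0 // ltW.
by rewrite le_max lexx orbT.
Qed.

Lemma amortized_cost_le (c phi0 phi1 b : nat) :
  (c + 4 * phi1 <= 4 * phi0 + b)%N ->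
  amortized_cost 4 c phi0 phi1 <= b%:R :> R.
Proof.
rewrite -(ler_nat R) (natrD _ c) (natrD _ (4 * _)) !(natrM _ 4) /amortized_cost => le_c.
by lra.
Qed.

End GoldenRatio.

(** * The amortized bounds *)

Local Open Scope ring_scope.

Theorem theorem1 (R : realType) (disp : Order.disp_t) (K : orderType disp) :
  exists kappa C : R, 0 < kappa /\
  [/\ (forall H : heap K,
         adaptive_heap (degree_bound R) H -> nodes H != fset0 ->
         (exists z H' c, extract_min (degree_bound R) H z H' c) /\
         (forall z H' c, extract_min (degree_bound R) H z H' c ->
            amortized_cost kappa c (potential H) (potential H')
              <= C * Num.max 1 (lg #|` nodes H|%:R))),
      (forall (H : heap K) x k,
         adaptive_heap (degree_bound R) H -> x \notin nodes H ->
         amortized_cost kappa (insert H x k).2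
           (potential H) (potential (insert H x k).1) <= C),
      (forall H : heap K,
         adaptive_heap (degree_bound R) H ->
         amortized_cost kappa (find_min H).2
           (potential H) (potential H) <= C),
      (forall H1 H2 : heap K,
         adaptive_heap (degree_bound R) H1 ->
         adaptive_heap (degree_bound R) H2 ->
         [disjoint nodes H1 & nodes H2]%fset ->
         amortized_cost kappa (union H1 H2).2
           (potential H1 + potential H2) (potential (union H1 H2).1) <= C)
    & (forall (H : heap K) x k,
         adaptive_heap (degree_bound R) H ->
         x \in nodes H -> (k <= key (store H x))%O ->
         (exists H' c, decrease_key H x k H' c) /\
         (forall H' c, decrease_key H x k H' c ->
            amortized_cost kappa c (potential H) (potential H') <= C))].
Proof.
have degD : forall (H : heap K) n x, forest H -> (#|` nodes H| <= n)%N ->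
    x \in nodes H -> (degree (store H x) <= degree_bound R n)%N.
  exact: degree_le_bound.
have wfP (H : heap K) := adaptive_heap_well_formed degD (H := H).
set rho : R := ln 2 / ln (golden_ratio R).
have rho_ge0 : 0 <= rho.
  rewrite divr_ge0 ?ltW ?ln_golden_ratio_gt0 //.
  by rewrite ln_gt0 // ltr1n.
(* [rho] converts logarithms from base 2 to the golden ratio, [11] is the slope for EXTRACT-MIN, and
   [15], from DECREASE-KEY, is the largest additive constant. *)
exists 4, (11 * rho + 15); split; first by rewrite ltr0n.
have cost_le (b : nat) c p0 p1 : (b <= 15)%N -> (c + 4 * p1 <= 4 * p0 + b)%N ->
    amortized_cost (4 : R) c p0 p1 <= 11 * rho + 15.
  move=> le_b /(@amortized_cost_le R) /le_trans; apply.
  have : b%:R <= 15%:R :> R by rewrite ler_nat.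
  by lra.
split.
- move=> H /wfP wf ne; split; first exact: extract_min_exists.
  move=> z H' c /(extract_min_spec degD wf)[_] /(@amortized_cost_le R) /le_trans.
  apply; have := @degree_bound_le R #|` nodes H|; rewrite -/rho natrD natrM.
  set M := Num.max _ _; set d := (degree_bound _ _)%:R => le_d.
  (* Since [M] is at least 1, the additive constant of EXTRACT-MIN is absorbed by [15 * M]. *)
  have M1 : 1 <= M by rewrite /M le_max lexx.
  by nra.
- by move=> H x k _ xN; apply: cost_le (insert_potential k xN).
- by move=> H _; apply: (cost_le 1%N) => //; rewrite addnC.
- by move=> H1 H2 _ _ dis; apply: cost_le (union_potential dis).
- move=> H x k /wfP wf xN le_k; split; first exact: decrease_key_exists.
  by move=> H' c /(decrease_key_spec wf xN le_k)[_]; apply: cost_le.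
Qed.
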